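(* Let $0<p_1,p_2<\infty$, $0<q_1,q_2\le\infty$, $r>0$ and $s<0$ be real numbers (with $q_i=\infty$ allowed). Let $$\theta=\frac{r}{r-s},\qquad \frac1p=\frac{1-\theta}{p_1}+\frac{\theta}{p_2},\qquad \frac1q=\frac{1-\theta}{q_1}+\frac{\theta}{q_2}.$$ Then there is a constant $c$, not depending on $f$, such that for every function $f\in S_0(\mathbb{R}^n)\cap\left(L^1(\mathbb{R}^n)+L^\infty(\mathbb{R}^n)\right)$, $$\|f\|_{p,q}\le c\,\|f\|_{\dot F^r_{p_1,q_1;\infty}}^{1-\theta}\,\|f\|_{\dot F^s_{p_2,q_2;\infty}}^{\theta}.$$
   Context: Conventions: $1/\infty=0$; the inequality is trivial when its right-hand side is infinite. $S_0(\mathbb{R}^n)$ is the class of measurable, almost everywhere finite functions $f$ on $\mathbb{R}^n$ with $\lambda_f(y)=|\{x:|f(x)|>y\}|<\infty$ for every $y>0$. For $f\in S_0(\mathbb{R}^n)$ the non-increasing rearrangement is $f^*(t)=\inf\{y>0:\lambda_f(y)<t\}$, $0<t<\infty$. Lorentz quasinorms: $\|f\|_{p,q}=\left(\int_0^\infty (t^{1/p}f^*(t))^q\,\frac{dt}{t}\right)^{1/q}$ for $0<p,q<\infty$, and $\|f\|_{p,\infty}=\sup_{t>0}t^{1/p}f^*(t)$ for $0<p\le\infty$. Let $p_h(y)=(4\pi h)^{-n/2}e^{-|y|^2/(4h)}$ and $P_hf(x)=\int_{\mathbb{R}^n}p_h(y)f(x-y)\,dy$, $h>0$. For $-\infty<s<\infty$,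 $0<p<\infty$, $0<q,l\le\infty$ and a non-negative integer $m$ with $2m>s$, the homogeneous Triebel-Lizorkin-Lorentz quasinorm is $$\|f\|_{\dot F^s_{p,q;l}}=\left\|\left(\int_0^\infty h^{(m-s/2)l}\left|\frac{\partial^mP_hf}{\partial h^m}(\cdot)\right|^l\frac{dh}{h}\right)^{1/l}\right\|_{p,q};$$ for $l=\infty$ this is $\|f\|_{\dot F^s_{p,q;\infty}}=\left\|\sup_{h>0}h^{m-s/2}\left|\frac{\partial^mP_hf}{\partial h^m}(\cdot)\right|\right\|_{p,q}$. One integer $m$ with $2m>r$ is fixed and used in both quasinorms in the statement; the constant may depend on $m$, $n$ and the parameters. *)

(* Defs.v *)
From HB Require Import structures.
From mathcomp Require Import all_boot all_order all_algebra.
From mathcomp Require Import all_classical all_reals all_analysis.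
From mathcomp Require Import measurable_realfun.

Set Implicit Arguments.
Unset Strict Implicit.
Unset Printing Implicit Defensive.

Import Order.TTheory GRing.Theory Num.Theory.
Import numFieldNormedType.Exports.

Local Open Scope classical_set_scope.
Local Open Scope ring_scope.

(* Lebesgue measure on R^n: the Borel version is the n-fold product of the
   one-dimensional Lebesgue measure, built by recursion on n; completing it
   yields the sigma-algebra of Lebesgue measurable sets. *)

Section borel_step.
Context (R : realType) (n : nat).
Variable mu : {sigma_finite_measure set (n.-tuple (measurableTypeR R)) -> \bar R}.

Definition tcons (x : measurableTypeR R * n.-tuple (measurableTypeR R)) :
    n.+1.-tuple (measurableTypeR R) :=
  [the n.+1.-tuple _ of x.1 :: x.2].

Lemma measurable_tcons : measurable_fun setT tcons.
Proof. exact: measurable_cons. Qed.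

Definition product_step : set (n.+1.-tuple (measurableTypeR R)) -> \bar R :=
  pushforward (lebesgue_measure \x mu)%E tcons.

Let product_step0 : product_step set0 = 0%E.
Proof. by rewrite /product_step /pushforward preimage_set0 measure0. Qed.

Let product_step_ge0 A : (0 <= product_step A)%E.
Proof. by rewrite /product_step /pushforward; exact: measure_ge0. Qed.

Let product_step_sigma_additive : semi_sigma_additive product_step.
Proof.
move=> F mF tF mUF; rewrite /product_step /pushforward preimage_bigcup.
have mpre A : measurable A -> measurable (tcons @^-1` A).
  by move=> mA; rewrite -[X in measurable X]setTI; exact: measurable_tcons.
apply: measure_semi_sigma_additive => [i||].
- exact: mpre.
- apply/trivIsetP => i j _ _ ij; rewrite -preimage_setI.
  by move/trivIsetP : tF => /(_ _ _ Logic.I Logic.I ij) ->; rewrite preimage_set0.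
- by rewrite -preimage_bigcup; exact: mpre.
Qed.

HB.instance Definition _ := isMeasure.Build _ _ _ product_step
  product_step0 product_step_ge0 product_step_sigma_additive.

Let product_step_sigma_finite : sigma_finite setT product_step.
Proof.
have /sigma_finiteP[F [TF ndF Foo]] := sigma_finiteT (@lebesgue_measure R).
have /sigma_finiteP[G [TG ndG Goo]] := sigma_finiteT mu.
pose u (t : n.+1.-tuple (measurableTypeR R)) := (thead t, [tuple of behead t]).
have uK : cancel tcons u.
  by case=> x t; rewrite /u /tcons/= theadE; congr (_, _); exact/val_inj.
have measurable_u : measurable_fun setT u.
  by apply/measurable_fun_pair; [exact: measurable_tnth|exact: measurable_behead].
exists (fun i => u @^-1` (F i `*` G i)) => [|i].
  apply/esym; rewrite -subTset => t _.
  have [i _ Fi] : (\bigcup_i F i) (u t).1 by rewrite -TF.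
  have [j _ Gj] : (\bigcup_i G i) (u t).2 by rewrite -TG.
  exists (maxn i j) => //; split.
  - by move: Fi; exact/subsetPset/ndF/leq_maxl.
  - by move: Gj; exact/subsetPset/ndG/leq_maxr.
have [mF Fi] := Foo i; have [mG Gi] := Goo i; split.
  by rewrite -[X in measurable X]setTI; apply: measurable_u => //; exact: measurableX.
rewrite /product_step /pushforward -comp_preimage.
rewrite (_ : u \o tcons = id) ?preimage_id; last exact/funext.
by rewrite product_measure1E// lte_mul_pinfty// ge0_fin_numE.
Qed.

HB.instance Definition _ :=
  Measure_isSigmaFinite.Build _ _ _ product_step product_step_sigma_finite.

End borel_step.

Fixpoint borel_lebesgue (R : realType) (n : nat) :
    {sigma_finite_measure set (n.-tuple (measurableTypeR R)) -> \bar R} :=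
  match n with
  | 0 => \d_ ([tuple] : 0.-tuple (measurableTypeR R))
  | k.+1 => product_step (borel_lebesgue R k)
  end.

Definition Rn (R : realType) (n : nat) : measurableType _ :=
  caratheodory_type ((borel_lebesgue R n)^*)%mu.

Definition leb (R : realType) (n : nat) : {measure set (Rn R n) -> \bar R} :=
  @completed_measure_extension _ (n.-tuple (measurableTypeR R)) R
    (borel_lebesgue R n).

Section rearrangement.
Context (R : realType) (n : nat).
Implicit Types (f : Rn R n -> \bar R) (p : R) (q : \bar R).
Local Open Scope ereal_scope.

Definition distr_fun f (y : R) : \bar R := leb R n [set x | y%:E < `|f x|].

Definition S0 f : Prop :=
  [/\ measurable_fun setT f,
      {ae leb R n, forall x, f x \is a fin_num} &
      forall y : R, (0 < y)%R -> distr_fun f y < +oo].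

Definition rearr f (t : R) : \bar R :=
  ereal_inf [set y%:E | y in [set y : R | (0 < y)%R /\ distr_fun f y < t%:E]].

(* Only q > 0 is meaningful; the value at q = -oo is a placeholder. *)
Definition lorentz p q f : \bar R :=
  match q with
  | q%:E => (\int[lebesgue_measure]_(t in `]0%R, +oo[)
              (((t `^ p^-1)%:E * rearr f t) `^ q * (t^-1)%:E)) `^ q^-1
  | +oo => ereal_sup [set (t `^ p^-1)%:E * rearr f t | t in [set t : R | (0 < t)%R]]
  | -oo => 0
  end.

Definition L1_plus_Loo f : Prop :=
  exists g k : Rn R n -> R,
    [/\ g \in Lfun (leb R n) 1, k \in Lfun (leb R n) +oo &
        {ae leb R n, forall x, f x = (g x + k x)%:E}].

End rearrangement.

Section heat_semigroup.
Context (R : realType) (n : nat).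
Implicit Types (f : Rn R n -> \bar R) (x y : Rn R n).

Definition sub_Rn x y : Rn R n :=
  [tuple tnth (x : n.-tuple R) i - tnth (y : n.-tuple R) i | i < n].

Definition heat_kernel (h : R) y : R :=
  (4 * pi * h) `^ (- (n%:R / 2)) *
  expR (- (\sum_(i < n) tnth (y : n.-tuple R) i ^+ 2) / (4 * h)).

Definition heat f (h : R) x : R :=
  fine (\int[leb R n]_y ((heat_kernel h y)%:E * f (sub_Rn x y)))%E.

Definition heat_deriv (m : nat) f (h : R) x : R :=
  derive1n m (fun h' => heat f h' x) h.

(* The inner l-quasinorm in h; as above, l = -oo is a placeholder. *)
Definition tl_fun (m : nat) (s : R) (l : \bar R) f x : \bar R :=
  match l with
  | l%:E => (\int[lebesgue_measure]_(h in `]0%R, +oo[)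
      (h `^ ((m%:R - s / 2) * l) * `|heat_deriv m f h x| `^ l / h)%:E) `^ l^-1
  | +oo => ereal_sup [set (h `^ (m%:R - s / 2) * `|heat_deriv m f h x|)%:E
                     | h in [set h : R | (0 < h)%R]]
  | -oo => 0
  end%E.

Definition tll_norm (m : nat) (s p : R) (q l : \bar R) f : \bar R :=
  lorentz p q (tl_fun m s l f).

End heat_semigroup.

(* Main.v *)
Require Import Defs.
From HB Require Import structures.
From mathcomp Require Import all_boot all_order all_algebra.
From mathcomp Require Import all_classical all_reals all_analysis.
From mathcomp Require Import measurable_realfun ess_sup_inf.
From mathcomp Require Import ring lra.

(** The inequality follows from a pointwise one, by Hoelder's inequality for
    Lorentz quasinorms.

    Fix a point x and put u(h) = P_h f(x).  Let A and B be the values at x of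
    the two maximal functions, so that |u^(m)(h)| is at most A h^(r/2 - m) and
    at most B h^(s/2 - m).  Since f is in S_0, u(h) tends to 0 as h grows, and
    so do its derivatives; integrating the second bound m times from infinity
    therefore gives |u(h)| <= C B h^(s/2), while the first bound controls the
    oscillation of u on (0, t] by C A t^(r/2).  At the height t where these two
    quantities agree, both are C A^(1-theta) B^theta, and this bounds u on the
    whole half-line [interpolate_derivative_bounds].  As P_h f(x) comes back to
    f(x) when h tends to 0, |f(x)| <= C A^(1-theta) B^theta for almost every x
    [pointwise_interpolation].  The right-hand side also makes sense when one
    factor is 0 and the other infinite: A and B are suprema of the same
    function up to positive factors, so they vanish together, and then
    f(x) = 0.

    Two facts about the heat semigroup enter here.  First, u is smooth and all
    its derivatives are what they should be: u is a finite combination of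
    products of a power of h with a Laplace-type integral taken at 1/(4h), and
    such combinations are stable under differentiation [is_derive_hcomb].
    Secondly, P_h f returns to f [heat_recovers].  As the bound on P_h f(x) is
    uniform in h, it is enough that this happens along some heights h, depending
    on x.  These are provided by convergence in the mean: the weighted integral
    of p_h(y) |f(x - y) - f(x)| over pairs (x, y) tends to 0.  The functions with
    that property form a closed class, the sets whose indicator has it form a
    sigma-algebra, and half-spaces are among them, being limits of Lipschitz
    ramps.

    All this is done for a Borel function F equal to f almost everywhere.  The
    hypotheses on f are used only through one property of F: for every e > 0,
    |F| is at most e plus an integrable function [small_plus_integrable].

    Finally, f^*(t) <= c A^*(t/2)^(1-theta) B^*(t/2)^theta, and the weighted
    arithmetic-geometric mean inequality, integrated against dt/t, gives the
    bound for Lorentz quasinorms [lorentz_hoelder]. *)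

Set Implicit Arguments.
Unset Strict Implicit.
Unset Printing Implicit Defensive.

Import Order.TTheory GRing.Theory Num.Theory.
Import numFieldNormedType.Exports.

Local Open Scope classical_set_scope.
Local Open Scope ring_scope.

(** * Functions on the half-line with two bounds on a derivative *)

(** The function (K / a) t^a - e v(t) has a nonnegative derivative for
    e = 1 and e = -1, hence is nondecreasing.  The sign of [a] is free: a
    negative [a] is used towards infinity, a positive one towards 0. *)
Lemma increment_le_powR (R : realType) (v dv : R -> R) (K a x y : R) :
  a != 0 -> 0 < x -> x <= y ->
  (forall t : R, 0 < t -> is_derive t 1 v (dv t)) ->
  (forall t : R, 0 < t -> `|dv t| <= K * t `^ (a - 1)) ->
  `|v y - v x| <= K / a * (y `^ a - x `^ a).
Proof.
move=> a0 x0 xy dvE dvK.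
have main (e : R) : `|e| = 1 -> e * (v y - v x) <= K / a * (y `^ a - x `^ a).
  move=> e1.
  pose w t := K / a * t `^ a - e * v t.
  have dw (t : R) : 0 < t -> is_derive t 1 w (K * t `^ (a - 1) - e * dv t).
    move=> t0.
    have h1 := is_derive1_powR a t0.
    have h2 := dvE _ t0.
    rewrite /w.
    have -> : K * t `^ (a - 1) - e * dv t = (K / a) *: (a * t `^ (a - 1)) - e *: dv t.
      by rewrite /GRing.scale /= mulrA divfK.
    by apply: is_deriveB.
  have dw0 t : 0 < t -> 0 <= K * t `^ (a - 1) - e * dv t.
    move=> t0; rewrite subr_ge0.
    apply: le_trans (dvK _ t0); apply: le_trans (ler_norm _) _.
    by rewrite normrM e1 mul1r.
  have wxy : w x <= w y.
    apply: (@ger0_derive1_ndecr _ w x y) => //.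
    - move=> t; rewrite in_itv/= => /andP[xt _].
      by have := dw t (lt_trans x0 xt); move=> /@ex_derive.
    - move=> t; rewrite in_itv/= => /andP[xt _].
      have t0 := lt_trans x0 xt; have dt := dw t t0.
      by rewrite derive1E derive_val; exact: dw0.
    - apply: derivable_within_continuous => t; rewrite in_itv/= => /andP[xt _].
      by have := dw t (lt_le_trans x0 xt); move=> /@ex_derive.
  rewrite /w /= in wxy; move: wxy.
  set p := K / a * x `^ a; set p' := K / a * y `^ a => wxy.
  rewrite (mulrBr e) (mulrBr (K / a)) -/p -/p'; lra.
rewrite ler_norml; apply/andP; split; last first.
  by have := main 1; rewrite normr1 mul1r; exact.
have := main (-1); rewrite normrN normr1 => /(_ erefl); lra.
Qed.

(** A function whose derivative stays above some d > 0 grows without bound,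
    hence stays above 1.  This is what excludes a nonzero limit at infinity
    for the derivatives of a function that tends to 0. *)
Lemma eventually_pos_antiderivative (R : realType) (k : nat) : forall (v : nat -> R -> R),
  (forall j, (j < k)%N -> forall t : R, 0 < t -> is_derive t 1 (v j) (v j.+1 t)) ->
  (exists2 d : R, 0 < d & exists2 X : R, 0 < X & forall t : R, X <= t -> d <= v k t) ->
  exists2 d : R, 0 < d & exists2 X : R, 0 < X & forall t : R, X <= t -> d <= v 0 t.
Proof.
elim: k => [//|k IH] v dv [d d0 [X X0 dX]].
apply: IH => [j jk|]; first by apply: dv; rewrite ltnS ltnW.
exists 1 => //.
have XX : X <= X + (1 + `|v k X|) / d.
  by rewrite lerDl divr_ge0 ?addr_ge0// ltW.
exists (X + (1 + `|v k X|) / d); first exact: lt_le_trans XX.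
move=> t Xt.
have Xt' := le_trans XX Xt.
have [||c] := @MVT_segment _ (v k) (v k.+1) X t Xt'.
- by move=> x; rewrite in_itv/= => /andP[Xx _]; apply: dv => //; apply: lt_trans Xx.
- apply: derivable_within_continuous => x; rewrite in_itv/= => /andP[Xx _].
  by have := dv k (ltnSn k) x (lt_le_trans X0 Xx); move=> /@ex_derive.
rewrite in_itv/= => /andP[Xc _] E.
have : (1 + `|v k X|) <= v k.+1 c * (t - X).
  apply: (@le_trans _ _ (d * (t - X))); last first.
    by apply: ler_wpM2r; [rewrite subr_ge0|apply: dX].
  by rewrite mulrC -ler_pdivrMr// lerBrDl.
rewrite -E; have := ler_norm (- v k X); rewrite normrN; lra.
Qed.

(** If |v k t| exceeded the bound at some t, the increments of [v k] beyond t
    would be too small to bring it back to 0, so it would stay away from 0 and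
    so would [v 0]. *)
Lemma integrate_from_infinity (R : realType) (v : nat -> R -> R) (K a : R) (k : nat) :
  a < 0 -> 0 <= K ->
  (forall j, (j <= k)%N -> forall t : R, 0 < t -> is_derive t 1 (v j) (v j.+1 t)) ->
  (forall e : R, 0 < e -> exists X : R, forall t : R, X <= t -> `|v 0 t| < e) ->
  (forall t, 0 < t -> `|v k.+1 t| <= K * t `^ (a - 1)) ->
  forall t, 0 < t -> `|v k t| <= K / - a * t `^ a.
Proof.
move=> a0 K0 dv v0 vK t t0.
have main (e : R) : `|e| = 1 -> e * v k t <= K / - a * t `^ a.
  move=> e1; rewrite leNgt; apply/negP => lt.
  have [j jk x x0||d d0 [X X0 dX]] :=
      @eventually_pos_antiderivative _ k (fun j x => e * v j x).
  - by apply: is_deriveZ; apply: dv => //; exact: ltnW.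
  - exists (e * v k t - K / - a * t `^ a); first by rewrite subr_gt0.
    exists t => // y ty.
    have := @increment_le_powR _ (v k) (v k.+1) K a t y (ltr0_neq0 a0) t0 ty (dv k (leqnn k)) vK.
    have : e * (v k t - v k y) <= `|v k y - v k t|.
      apply: le_trans (ler_norm _) _.
      by rewrite normrM e1 mul1r distrC.
    have : 0 <= K / - a * y `^ a.
      by rewrite mulr_ge0 ?powR_ge0// divr_ge0// oppr_ge0 ltW.
    rewrite invrN mulrN !mulNr.
    set p := K / a * t `^ a; set p' := K / a * y `^ a.
    rewrite mulrBr (mulrBr (K / a)) -/p -/p'; lra.
  - have [Y Yd] := v0 _ d0.
    have := dX (Num.max X Y); rewrite le_max lexx => /(_ isT).
    have := Yd (Num.max X Y); rewrite le_max lexx orbT => /(_ isT).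
    have := ler_norm (e * v 0 (Num.max X Y)); rewrite normrM e1 mul1r; lra.
rewrite ler_norml; apply/andP; split; last first.
  by have := main 1; rewrite normr1 mul1r; exact.
have := main (-1); rewrite normrN normr1 => /(_ erefl); lra.
Qed.

(** Every integration lowers the exponent's shift by one; as long as
    b < l all the exponents met on the way down to level [l] are negative. *)
Lemma integrate_from_infinity_iter (R : realType) (b : R) (m l : nat) : b < l%:R -> (l <= m)%N ->
  exists2 C : R, 0 <= C & forall (v : nat -> R -> R) (K : R), 0 <= K ->
  (forall j, (j < m)%N -> forall t : R, 0 < t -> is_derive t 1 (v j) (v j.+1 t)) ->
  (forall e : R, 0 < e -> exists X : R, forall t : R, X <= t -> `|v 0 t| < e) ->
  (forall t, 0 < t -> `|v m t| <= K * t `^ (b - m%:R)) ->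
  forall t, 0 < t -> `|v l t| <= C * K * t `^ (b - l%:R).
Proof.
move=> bl; elim: m => [|m IH].
  rewrite leqn0 => /eqP l0; rewrite l0; exists 1 => // v K K0 _ _ h t t0.
  by rewrite mul1r; apply: h.
rewrite leq_eqVlt => /orP[/eqP <-|].
  by exists 1 => // v K K0 _ _ h t t0; rewrite mul1r; apply: h.
rewrite ltnS => lm; have [C C0 HC] := IH lm.
have bm : b - m%:R < 0 by rewrite subr_lt0; apply: lt_le_trans bl _; rewrite ler_nat.
exists (C / - (b - m%:R)).
  by rewrite divr_ge0// oppr_ge0 ltW.
move=> v K K0 dv v0 vm t t0.
rewrite (_ : C / - (b - m%:R) * K = C * (K / - (b - m%:R))); last first.
  by rewrite mulrAC mulrA.
apply: HC => //.
- by rewrite divr_ge0// oppr_ge0 ltW.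
- by move=> j jm; apply: dv; rewrite ltnS ltnW.
- apply: integrate_from_infinity => // x x0.
  rewrite (_ : b - m%:R - 1 = b - m.+1%:R); first exact: vm.
  by rewrite -addrA -opprD -natr1.
Qed.

Lemma powR_expR (R : realType) (t x : R) : 0 < t -> t `^ x = expR (x * ln t).
Proof. by move=> t0; rewrite /powR gt_eqF. Qed.

(** The minimum of the two bounds is at most K t^-m (t / t0)^b for every
    b between s/2 and r/2, where t0 is the point at which they agree.  With
    b = s/2 one can integrate down to [v 0] and bound it on [t0, +oo[; with
    0 < b < 1 one can integrate down to [v 1] and then bound the oscillation of
    [v 0] on ]0, t0]. *)
Lemma interpolate_derivative_bounds (R : realType) (m : nat) (r s : R) :
  0 < r -> s < 0 -> (0 < m)%N ->
  exists2 C : R, 0 < C & forall (v : nat -> R -> R) (A B : R), 0 < A -> 0 < B ->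
  (forall j, (j < m)%N -> forall t : R, 0 < t -> is_derive t 1 (v j) (v j.+1 t)) ->
  (forall e : R, 0 < e -> exists X : R, forall t : R, X <= t -> `|v 0 t| < e) ->
  (forall t, 0 < t -> t `^ (m%:R - r / 2) * `|v m t| <= A) ->
  (forall t, 0 < t -> t `^ (m%:R - s / 2) * `|v m t| <= B) ->
  forall t, 0 < t -> `|v 0 t| <= C * (A `^ (1 - r / (r - s)) * B `^ (r / (r - s))).
Proof.
move=> r0 s0 m0.
(* the exponent used on ]0, t0]: below 1, in order to stop at level 1, and
   at most r/2 *)
pose a := Num.min r 1 / 2.
have a0 : 0 < a by rewrite /a divr_gt0// lt_min r0/=.
have a1 : a < 1 by rewrite /a ltr_pdivrMr// mul1r gt_min ltr1n orbT.
have [|C1 C10 H1] := @integrate_from_infinity_iter R a m 1 _ m0; first by [].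
have [|C2 C20 H2] := @integrate_from_infinity_iter R (s / 2) m 0 _ (leq0n m).
  by rewrite ltr_pdivrMr// mul0r.
exists (C1 / a + C2 + 1); first by rewrite ltr_wpDl// addr_ge0// divr_ge0// ltW.
move=> v A B A0 B0 dv v0 vA vB.
have rs : 0 < r - s by rewrite subr_gt0; exact: lt_trans s0 r0.
have rs0 : r - s != 0 by rewrite gt_eqF.
(* A t0^(r/2) = B t0^(s/2) *)
pose t0 := (B / A) `^ (2 / (r - s)).
have t00 : 0 < t0 by rewrite powR_gt0// divr_gt0.
set M := A `^ _ * B `^ _.
have A0' : A != 0 by rewrite gt_eqF.
have B0' : B != 0 by rewrite gt_eqF.
pose al := ln A; pose be := ln B; pose ta := ln t0.
have taE : ta = 2 / (r - s) * (be - al).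
  by rewrite /ta /t0 ln_powR ln_div ?posrE.
have ME : M = expR (al + r / 2 * ta).
  rewrite /M !powR_expR// -expRD; congr expR; rewrite -/al -/be taE; field; exact: rs0.
have ME' : M = expR (be + s / 2 * ta).
  rewrite /M !powR_expR// -expRD; congr expR; rewrite -/al -/be taE; field; exact: rs0.
have M0 : 0 < M by rewrite mulr_gt0// powR_gt0.
have key b t : s / 2 <= b -> b <= r / 2 -> 0 < t ->
    `|v m t| <= (M * t0 `^ (- b)) * t `^ (b - m%:R).
  move=> sb br tp.
  have [tt0|t0t] := leP t t0.
  - have : ln t <= ta by rewrite ler_ln.
    move=> tta.
    have := vA _ tp; rewrite mulrC -ler_pdivlMr ?powR_gt0// => /le_trans; apply.
    rewrite -powRN ME !powR_expR// -[A in A * _]lnK ?posrE// -!expRD ler_expR -/ta -/al.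
    have : 0 <= (r / 2 - b) * (ta - ln t) by rewrite mulr_ge0// subr_ge0.
    lra.
  - have : ta <= ln t by rewrite ler_ln// ltW.
    move=> tta.
    have := vB _ tp; rewrite mulrC -ler_pdivlMr ?powR_gt0// => /le_trans; apply.
    rewrite -powRN ME' !powR_expR// -[B in B * _]lnK ?posrE// -!expRD ler_expR -/ta -/be.
    have : 0 <= (b - s / 2) * (ln t - ta) by rewrite mulr_ge0// subr_ge0.
    lra.
have k0 b : 0 <= M * t0 `^ (- b) by rewrite mulr_ge0 ?powR_ge0// ltW.
have sr : s / 2 <= r / 2 by lra.
have ar : a <= r / 2 by rewrite /a ler_pM2r// ge_min lexx.
have sa : s / 2 <= a by lra.
have h1 := H1 v _ (k0 a) dv v0 (fun t tp => key a t sa ar tp).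
have h2 := H2 v _ (k0 (s / 2)) dv v0 (fun t tp => key (s / 2) t (lexx _) sr tp).
have s20 : s / 2 < 0 by lra.
have b0 t : t0 <= t -> `|v 0 t| <= C2 * M.
  move=> tt0; have tp : 0 < t := lt_le_trans t00 tt0.
  apply: le_trans (h2 _ tp) _.
  rewrite -mulrA ler_wpM2l// -mulrA -[leRHS]mulr1 ler_wpM2l// ?(ltW M0)//.
  rewrite subr0 !powR_expR// -expRD -[leRHS]expR0 ler_expR.
  have : ta <= ln t by rewrite ler_ln.
  move=> tta; have : 0 <= - (s / 2) * (ln t - ta) by rewrite mulr_ge0// ?subr_ge0// oppr_ge0 ltW.
  rewrite -/ta; lra.
have ap : a != 0 by rewrite gt_eqF.
have b1 t : 0 < t -> t <= t0 -> `|v 0 t0 - v 0 t| <= C1 / a * M.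
  move=> tp tt0.
  have := @increment_le_powR _ (v 0) (v 1) (C1 * (M * t0 `^ (- a))) a t t0 ap tp tt0 (dv 0%N m0) h1.
  move=> /le_trans; apply.
  apply: (@le_trans _ _ (C1 * (M * t0 `^ (- a)) / a * t0 `^ a)).
    apply: ler_wpM2l; last by rewrite gerBl powR_ge0.
    by apply: divr_ge0; [exact: mulr_ge0|exact: ltW].
  rewrite powRN; have : t0 `^ a != 0 by rewrite gt_eqF// powR_gt0.
  move=> t0a; rewrite le_eqVlt; apply/orP; left; apply/eqP; field.
  by rewrite ap t0a.
have pC1 : 0 <= C1 / a by rewrite divr_ge0// ltW.
move=> t tp; have [tt0|/ltW t0t] := leP t t0.
- have h := b1 t tp tt0; have h' := b0 _ (lexx _).
  have : `|v 0 t| <= `|v 0 t0| + `|v 0 t0 - v 0 t|.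
    by rewrite -[v 0 t in leLHS](subKr (v 0 t0)); apply: ler_normB.
  rewrite !mulrDl mul1r; lra.
- have := b0 t t0t; have := mulr_ge0 pC1 (ltW M0); rewrite !mulrDl mul1r; lra.
Qed.

(** * Rearrangements and Lorentz quasinorms *)

Section ge0_le_integral_nomeas.
Import HBNNSimple.

(** The integral of a nonnegative function, measurable or not, is a supremum
    over the simple functions below it. *)
Lemma ge0_le_integral_nomeas d (T : measurableType d) (R : realType)
    (mu : {measure set T -> \bar R}) (D : set T) (f1 f2 : T -> \bar R) :
  (forall x, D x -> 0 <= f1 x)%E -> (forall x, D x -> f1 x <= f2 x)%E ->
  (\int[mu]_(x in D) f1 x <= \int[mu]_(x in D) f2 x)%E.
Proof.
move=> f10 f12; rewrite !(integral_mkcond D).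
have h12 x : ((f1 \_ D) x <= (f2 \_ D) x)%E by apply: lee_restrict.
rewrite !ge0_integralTE.
- apply: ereal_sup_le => _ [h hf <-]; by exists h => //= x; apply: le_trans (hf x) (h12 x).
- by move=> x; apply: erestrict_ge0 => // t /[dup] Dt /f12; apply: le_trans; exact: f10.
- by move=> x; apply: erestrict_ge0.
Qed.

End ge0_le_integral_nomeas.

Section rearrangement_theory.
Context (R : realType) (n : nat).
Implicit Types (f g : Rn R n -> \bar R).
Local Open Scope ereal_scope.

(** [leb] is an outer measure evaluated on all sets; its monotonicity and
    subadditivity are used on level sets that are not known to be
    measurable. *)
Lemma leb_le (A B : set (Rn R n)) : A `<=` B -> leb R n A <= leb R n B.
Proof. exact: (@le_outer_measure _ _ ((borel_lebesgue R n)^*)%mu). Qed.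

Lemma leb_le_setU (A B : set (Rn R n)) : leb R n (A `|` B) <= leb R n A + leb R n B.
Proof. exact: (outer_measureU2 ((borel_lebesgue R n)^*)%mu). Qed.

Lemma leb_bigcup_eq0 (A : (set (Rn R n))^nat) :
  (forall i, leb R n (A i) = 0) -> leb R n (\bigcup_i A i) = 0.
Proof.
move=> A0; apply/eqP; rewrite eq_le; apply/andP; split; last exact: (outer_measure_ge0 ((borel_lebesgue R n)^*)%mu).
have := outer_measure_sigma_subadditive ((borel_lebesgue R n)^*)%mu A.
move=> /le_trans; apply.
by rewrite eseries0// => i _ _; exact: A0.
Qed.

Lemma distr_fun_ge0 f y : 0 <= distr_fun f y.
Proof. exact: (outer_measure_ge0 ((borel_lebesgue R n)^*)%mu). Qed.

Lemma le_distr_fun f y z : (y <= z)%R -> distr_fun f z <= distr_fun f y.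
Proof.
by move=> yz; apply: leb_le => x /=; apply: le_lt_trans; rewrite lee_fin.
Qed.

Lemma rearr_ge0 f t : 0 <= rearr f t.
Proof. by apply: le_ereal_inf_tmp => _ [y [y0 _] <-]; rewrite lee_fin ltW. Qed.

Lemma le_rearr f t u : (t <= u)%R -> rearr f u <= rearr f t.
Proof.
move=> tu; apply: ereal_inf_le_tmp => _ [y [y0 yt] <-]; exists y => //; split => //.
by apply: lt_le_trans yt _; rewrite lee_fin.
Qed.

Lemma measurable_rearr f (D : set R) : measurable D -> measurable_fun D (rearr f).
Proof.
move=> mD; apply: (measurability _ (ErealGenCInfty.measurableE R)).
move=> _ [_] [r] -> <-.
apply: measurableI => //; apply: is_interval_measurable => s t/=.
rewrite !in_itv/= !andbT => fs ft u /andP[su ut].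
by rewrite in_itv/= andbT (le_trans ft)// le_rearr.
Qed.

Lemma distr_fun_lt_rearr f y t : rearr f t < y%:E -> distr_fun f y < t%:E.
Proof.
move=> /ereal_inf_lt[_ [z [z0 zt] <-]]; rewrite lte_fin => zy.
by apply: le_lt_trans zt; apply: le_distr_fun; exact: ltW.
Qed.

Lemma distr_fun_rearr_eq0 f : (forall t, (0 < t)%R -> rearr f t = 0) ->
  forall y, (0 < y)%R -> distr_fun f y = 0.
Proof.
move=> f0 y y0; apply/eqP; rewrite eq_le distr_fun_ge0 andbT.
apply/lee_addgt0Pr => e e0; rewrite add0e; apply/ltW.
by apply: distr_fun_lt_rearr; rewrite f0// lte_fin.
Qed.

(** [rearr f] is nonincreasing, so its value at [t] bounds it from below on
    ]0, t].  Hence a finite quasinorm forces a finite rearrangement, and a zero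
    quasinorm a zero one. *)
Lemma lorentz_ge_rearr (p : R) (q : \bar R) (t : R) : (0 < p)%R -> (0 < t)%R -> 0 < q ->
  exists2 k : R, (0 < k)%R &
    forall f (y : R), (0 < y)%R -> y%:E <= rearr f t -> (k * y)%:E <= lorentz p q f.
Proof.
move=> p0 t0; case: q => [q||]//.
- rewrite lte_fin => q0.
  pose a := ((t / 2) `^ p^-1)%R.
  have t20 : (0 < t / 2)%R by rewrite divr_gt0.
  have a0 : (0 < a)%R by rewrite powR_gt0.
  have aP s : (t / 2 <= s)%R -> (a <= s `^ p^-1)%R.
    move=> ts; apply: ge0_ler_powR; rewrite ?nnegrE ?invr_ge0 ?(ltW p0) ?(ltW t20)//.
    exact: le_trans (ltW t20) ts.
  exists ((a `^ q * 2^-1) `^ q^-1)%R.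
    by rewrite powR_gt0// mulr_gt0// ?powR_gt0// invr_gt0.
  move=> f y y0 yf.
  have -> : ((a `^ q * 2^-1) `^ q^-1 * y)%:E =
      (((a * y) `^ q * t^-1)%:E * (t / 2)%:E) `^ q^-1.
    rewrite -EFinM poweR_EFin; congr EFin.
    rewrite -mulrA (_ : t^-1 * (t / 2) = 2^-1)%R; last by field; rewrite gt_eqF.
    rewrite (@powRM _ a y) ?ltW// (mulrAC (a `^ q)%R).
    rewrite (@powRM _ _ (y `^ q)%R) ?mulr_ge0 ?powR_ge0 ?invr_ge0//.
    by rewrite -(powRrM y) mulfV ?gt_eqF// powRr1 1?ltW.
  rewrite /lorentz; apply: gt0_ler_poweR.
  + by rewrite invr_ge0 ltW.
  + by rewrite in_itv/= leey andbT -EFinM lee_fin !mulr_ge0 ?powR_ge0 ?invr_ge0 ?ltW.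
  + rewrite in_itv/= leey andbT; apply: integral_ge0 => s; rewrite /= in_itv/= andbT => s0.
    by rewrite mule_ge0 ?poweR_ge0// lee_fin invr_ge0 ltW.
  have I : lebesgue_measure (`](t / 2)%R, t]%classic : set R) = (t / 2)%:E.
    rewrite lebesgue_measure_itv/= lte_fin ltr_pdivrMr// ltr_pMr// ltr1n/= -EFinB.
    by congr EFin; field.
  rewrite -I -integral_cst//.
  rewrite integral_mkcond [leRHS]integral_mkcond; apply: ge0_le_integral_nomeas => s _.
    apply: erestrict_ge0 => x _; rewrite lee_fin mulr_ge0 ?powR_ge0 ?invr_ge0 ?ltW//.
  rewrite /patch; case: ifPn => [|_]; last first.
    case: ifPn => //; rewrite inE/= in_itv/= andbT => s0.
    by rewrite mule_ge0 ?poweR_ge0// lee_fin invr_ge0 ltW.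
  rewrite inE/= in_itv/= => /andP[ts st].
  have s0 : (0 < s)%R by apply: lt_trans ts; rewrite divr_gt0.
  rewrite ifT; last by rewrite inE/= in_itv/= s0.
  rewrite EFinM; apply: lee_pmul.
  + by rewrite lee_fin powR_ge0.
  + by rewrite lee_fin invr_ge0 ltW.
  + rewrite -poweR_EFin; apply: gt0_ler_poweR; first exact: ltW.
    * by rewrite in_itv/= leey andbT lee_fin mulr_ge0 ?ltW.
    * by rewrite in_itv/= leey andbT mule_ge0 ?rearr_ge0// lee_fin powR_ge0.
    rewrite EFinM; apply: lee_pmul.
    * by rewrite lee_fin ltW.
    * by rewrite lee_fin ltW.
    * by rewrite lee_fin; apply: aP; exact: ltW.
    * exact: le_trans yf (le_rearr _ st).
  + by rewrite lee_fin lef_pV2 ?posrE.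
- move=> _; exists (t `^ p^-1)%R; first by rewrite powR_gt0.
  move=> f y y0 yf; rewrite /lorentz.
  apply: (@le_trans _ _ ((t `^ p^-1)%:E * rearr f t)).
    by rewrite EFinM lee_pmul// ?lee_fin ?powR_ge0 ?ltW.
  by apply: ereal_sup_ubound; exists t.
Qed.

Lemma lorentz_eq0_rearr p q f t : (0 < p)%R -> 0 < q -> lorentz p q f = 0 -> (0 < t)%R ->
  rearr f t = 0.
Proof.
move=> p0 q0 f0 t0; apply/eqP; rewrite eq_le rearr_ge0 andbT leNgt; apply/negP => lt.
have [k k0 H] := @lorentz_ge_rearr p q t p0 t0 q0.
have [y y0 yf] : exists2 y : R, (0 < y)%R & y%:E <= rearr f t.
  case: (rearr f t) lt => [y||]//; first by rewrite lte_fin => y0; exists y.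
  by move=> _; exists 1%R => //; rewrite leey.
by have := H f y y0 yf; rewrite f0 lee_fin leNgt mulr_gt0.
Qed.

Lemma lorentz_lty_rearr p q f t : (0 < p)%R -> 0 < q -> lorentz p q f < +oo -> (0 < t)%R ->
  rearr f t < +oo.
Proof.
move=> p0 q0 fy t0; rewrite ltNge leye_eq; apply/negP => /eqP ty.
have [k k0 H] := @lorentz_ge_rearr p q t p0 t0 q0.
have L0 : 0 <= lorentz p q f.
  have := H f 1%R ltr01; rewrite ty leey => /(_ isT); apply: le_trans.
  by rewrite lee_fin mulr1 ltW.
case E : (lorentz p q f) fy L0 => [l||]// _ l0.
have := H f ((l + 1) / k)%R; rewrite ty leey E lee_fin => h.
have : (k * ((l + 1) / k) <= l)%R.
  by apply: h => //; rewrite divr_gt0// ltr_wpDl// -lee_fin.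
by rewrite mulrC divfK ?gt_eqF//; apply/negP; rewrite -ltNge ltrDl.
Qed.

End rearrangement_theory.

Lemma lee_poweR (R : realType) (x y : \bar R) (r : R) : 0 <= r -> (0 <= x)%E ->
  (x <= y)%E -> (x `^ r <= y `^ r)%E.
Proof.
move=> r0 x0 xy; apply: gt0_ler_poweR => //; rewrite in_itv/= leey andbT//.
exact: le_trans x0 xy.
Qed.

(** Both sides are measures, so it is enough to compare them on bounded
    intervals. *)
Lemma lebesgue_measure_scale (R : realType) (k : R) (A : set R) : 0 < k -> measurable A ->
  (lebesgue_measure A = k%:E *
    pushforward lebesgue_measure ( *%R k : measurableTypeR R -> measurableTypeR R) A)%E.
Proof.
move=> k0 mA.
have mk : measurable_fun [set: measurableTypeR R] ( *%R k : measurableTypeR R -> measurableTypeR R).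
  exact: mulrl_measurable.
pose kn : {nonneg R} := NngNum (ltW k0).
pose pf : {measure set (measurableTypeR R) -> \bar R} :=
  pushforward lebesgue_measure ( *%R k : measurableTypeR R -> measurableTypeR R).
pose mu := mscale kn (pf mk).
rewrite -[RHS]/(mu A).
apply: lebesgue_measure_unique => // _ [[a b]] _ <-.
rewrite -[RHS]/(k%:E * lebesgue_measure ( *%R k @^-1` `]a, b]%classic : set R))%E.
rewrite [X in (_ * lebesgue_measure X)%E](_ : _ = `]a / k, b / k]%classic); last first.
  by apply/seteqP; split => x; rewrite /= !in_itv/= ltr_pdivrMr// ler_pdivlMr// mulrC.
rewrite !lebesgue_measure_itv/= !lte_fin ltr_pM2r ?invr_gt0//.
case: ifPn => // _; last by rewrite mule0.
by rewrite -EFinM; congr EFin; field; rewrite gt_eqF.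
Qed.

Lemma ge0_integral_scale (R : realType) (k : R) (f : R -> \bar R) : 0 < k ->
  measurable_fun setT f -> (forall x, 0 <= f x)%E ->
  (\int[lebesgue_measure]_x f x = k%:E * \int[lebesgue_measure]_x f (k * x)%R)%E.
Proof.
move=> k0 mf f0.
have mk : measurable_fun [set: measurableTypeR R] ( *%R k : measurableTypeR R -> measurableTypeR R).
  exact: mulrl_measurable.
pose kn : {nonneg R} := NngNum (ltW k0).
pose pf : {measure set (measurableTypeR R) -> \bar R} :=
  pushforward lebesgue_measure ( *%R k : measurableTypeR R -> measurableTypeR R).
pose mu := mscale kn (pf mk).
transitivity (\int[mu]_x f x)%E.
  apply: eq_measure_integral => A mA _; exact: lebesgue_measure_scale.
rewrite /mu ge0_integral_mscale//; congr (_ * _)%E.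
by rewrite ge0_integral_pushforward.
Qed.

Lemma measurable_invr_itv (R : realType) :
  measurable_fun (`]0%R, +oo[%classic : set R) (@GRing.inv R).
Proof.
apply: (@eq_measurable_fun _ _ _ _ _ (fun x => x `^ (-1))).
  by move=> x; rewrite inE/= in_itv/= andbT => x0; rewrite powR_inv1// ltW.
by apply: measurable_funTS; exact: measurable_powR.
Qed.

(** The invariance of the measure dx/x absorbs the passage from t to t/2 in the
    rearrangement of a product. *)
Lemma ge0_integral_dilation (R : realType) (k : R) (g : R -> R) : 0 < k ->
  measurable_fun (`]0%R, +oo[%classic : set R) g -> (forall x, 0 <= g x) ->
  (\int[lebesgue_measure]_(x in `]0%R, +oo[) (g (k * x) / x)%:E =
   \int[lebesgue_measure]_(x in `]0%R, +oo[) (g x / x)%:E)%E.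
Proof.
move=> k0 mg g0.
have mgx : measurable_fun (`]0%R, +oo[%classic : set R) (fun x => (g x / x)%:E).
  apply/measurable_EFinP/measurable_funM => //.
  exact: measurable_invr_itv.
rewrite [LHS]integral_mkcond [RHS]integral_mkcond.
rewrite [RHS](ge0_integral_scale k0).
- rewrite -ge0_integralZl//.
  + apply: eq_integral => x _; rewrite !patchE.
    have -> : (k * x \in `]0, +oo[%classic) = (x \in `]0, +oo[%classic).
      by apply/idP/idP; rewrite !inE/= !in_itv/= !andbT pmulr_rgt0.
    case: ifPn => [|_]; last by rewrite mule0.
    rewrite inE/= in_itv/= andbT => x0; rewrite -EFinM; congr EFin.
    by field; rewrite !gt_eqF.
  + apply: measurableT_comp => //; exact/(measurable_restrictT _ _).1.
  + move=> x _; apply: erestrict_ge0 => y; rewrite /= in_itv/= andbT => y0.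
    by rewrite lee_fin divr_ge0// ltW.
  + by rewrite lee_fin ltW.
- exact/(measurable_restrictT _ _).1.
- move=> x; apply: erestrict_ge0 => y; rewrite /= in_itv/= andbT => y0.
  by rewrite lee_fin divr_ge0// ltW.
Qed.

(** The exponents may be 0, in which case 0^0 = 1 makes the inequality an
    equality; otherwise this is Young's inequality. *)
Lemma weighted_amgm (R : realType) (x y a b : R) : 0 <= x -> 0 <= y ->
  0 <= a -> 0 <= b -> a + b = 1 -> x `^ a * y `^ b <= a * x + b * y.
Proof.
move=> x0 y0; rewrite le_eqVlt => /predU1P[<- _|a0].
  by rewrite add0r => ->; rewrite powRr0 powRr1// !mul1r mul0r add0r.
rewrite le_eqVlt => /predU1P[<-|b0 ab].
  by rewrite addr0 => ->; rewrite powRr0 powRr1// !mulr1 mul1r mul0r addr0.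
have := @conjugate_powR R (x `^ a) (y `^ b) a^-1 b^-1.
rewrite !invrK -!powRrM !mulfV ?gt_eqF// !powRr1//.
rewrite (mulrC a) (mulrC b); apply => //; rewrite ?powR_ge0 ?invr_gt0//.
Qed.

(** Strict bounds a and b for which the mean loses only a factor 2: doubling
    both numbers multiplies the mean by 2, and if one of them is 0 it can be
    replaced by something small enough to compensate for the other one. *)
Lemma geomean_approx (R : realType) (th al be d : R) : 0 < th -> th < 1 ->
  0 <= al -> 0 <= be -> 0 < d -> exists a b : R,
  [/\ al < a, be < b & a `^ (1 - th) * b `^ th <= 2 * (al `^ (1 - th) * be `^ th) + d].
Proof.
move=> th0 th1 al0 be0 d0.
have th1' : 0 < 1 - th by rewrite subr_gt0.
have P0 : 0 <= 2 * (al `^ (1 - th) * be `^ th) by rewrite !mulr_ge0 ?powR_ge0.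
have [al1|al1] := eqVneq al 0.
  exists ((d / (be + 1) `^ th) `^ (1 - th)^-1), (be + 1).
  have b1 : 0 < (be + 1) `^ th by rewrite powR_gt0// ltr_wpDl.
  split; [|by rewrite ltrDl|].
    by rewrite al1 powR_gt0// divr_gt0.
  rewrite -powRrM mulVf ?gt_eqF// powRr1 ?divfK ?gt_eqF//; last by rewrite divr_ge0 ?ltW.
  by rewrite lerDr.
have [be1|be1] := eqVneq be 0.
  exists (al + 1), ((d / (al + 1) `^ (1 - th)) `^ th^-1).
  have b1 : 0 < (al + 1) `^ (1 - th) by rewrite powR_gt0// ltr_wpDl.
  split; [by rewrite ltrDl| |].
    by rewrite be1 powR_gt0// divr_gt0.
  rewrite -powRrM mulVf ?gt_eqF// powRr1; last by rewrite divr_ge0 ?ltW.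
  by rewrite mulrC divfK ?gt_eqF// lerDr.
have al2 : 0 < al by rewrite lt_neqAle eq_sym al1.
have be2 : 0 < be by rewrite lt_neqAle eq_sym be1.
exists (2 * al), (2 * be); split; [by lra|by lra|].
rewrite !powRM// mulrACA -powRD; last by rewrite pnatr_eq0 implybT.
by rewrite subrK powRr1// lerDl ltW.
Qed.

Section lorentz_hoelder.
Context (R : realType) (n : nat).
Local Open Scope ereal_scope.

Section geomean.
Variables (th C : R) (F A B : Rn R n -> \bar R) (N : set (Rn R n)).
Hypotheses (th0 : (0 < th)%R) (th1 : (th < 1)%R) (C0 : (0 < C)%R).
Hypotheses (A0 : forall x, 0 <= A x) (B0 : forall x, 0 <= B x).
Hypotheses (N0 : leb R n N = 0).
Hypothesis FAB : forall x, ~ N x -> `|F x| <= C%:E * (A x `^ (1 - th) * B x `^ th).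

Let th1' : (0 < 1 - th)%R. Proof. by rewrite subr_gt0. Qed.

(** If |F x| exceeds the mean of [a] and [b], then A x > a or B x > b; each
    of these level sets has measure less than t / 2. *)
Lemma rearr_geomean_lt (a b t : R) : (0 < a)%R -> (0 < b)%R ->
  rearr A (t / 2) < a%:E -> rearr B (t / 2) < b%:E ->
  rearr F t <= (C * (a `^ (1 - th) * b `^ th))%:E.
Proof.
move=> a0 b0 /distr_fun_lt_rearr Aa /distr_fun_lt_rearr Bb.
apply: ereal_inf_lbound; exists (C * (a `^ (1 - th) * b `^ th))%R => //; split.
  by rewrite !mulr_gt0// powR_gt0.
have : leb R n (N `|` ([set x | a%:E < `|A x|] `|` [set x | b%:E < `|B x|])) < t%:E.
  apply: le_lt_trans (leb_le_setU _ _) _; rewrite N0 add0e.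
  apply: le_lt_trans (leb_le_setU _ _) _.
  rewrite (_ : t%:E = (t / 2)%:E + (t / 2)%:E); last first.
    by rewrite -EFinD; congr EFin; field.
  exact: lteD.
apply: le_lt_trans; apply: leb_le => x /=; apply: contraPP.
move=> /not_orP[Nx /not_orP[/negP Ax /negP Bx]].
move: Ax Bx; rewrite -!leNgt (gee0_abs (A0 x)) (gee0_abs (B0 x)) => Ax Bx.
apply/negP; rewrite -leNgt; apply: le_trans (FAB Nx) _.
rewrite EFinM lee_pmul2l// ?lte_fin// EFinM; apply: lee_pmul; rewrite ?poweR_ge0//.
- by rewrite -poweR_EFin; apply: lee_poweR => //; exact: ltW.
- by rewrite -poweR_EFin; apply: lee_poweR => //; exact: ltW.
Qed.

Lemma rearr_geomean (t : R) : rearr A (t / 2) < +oo -> rearr B (t / 2) < +oo ->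
  rearr F t <=
  (2 * C * (fine (rearr A (t / 2)) `^ (1 - th) * fine (rearr B (t / 2)) `^ th))%:E.
Proof.
move=> Ay By.
have Af : rearr A (t / 2) \is a fin_num by rewrite ge0_fin_numE// rearr_ge0.
have Bf : rearr B (t / 2) \is a fin_num by rewrite ge0_fin_numE// rearr_ge0.
have al0 := fine_ge0 (rearr_ge0 A (t / 2)).
have be0 := fine_ge0 (rearr_ge0 B (t / 2)).
apply/lee_addgt0Pr => e e0.
have [a [b [aal bbe ab]]] := geomean_approx th0 th1 al0 be0 (divr_gt0 e0 C0).
apply: le_trans (@rearr_geomean_lt a b t _ _ _ _) _.
- exact: le_lt_trans aal.
- exact: le_lt_trans bbe.
- by rewrite -(fineK Af) lte_fin.
- by rewrite -(fineK Bf) lte_fin.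
rewrite -EFinD lee_fin; have := ler_wpM2l (ltW C0) ab.
rewrite mulrDr (mulrC C (e / C)%R) divfK ?gt_eqF// (mulrC 2%R C) -(mulrA C 2%R); exact.
Qed.

(** If one of the two functions vanishes almost everywhere, so does the
    product, even where the other one is infinite.  This is the case in which
    the right-hand side of Hoelder's inequality may read 0 times infinity. *)
Lemma lorentz_geomean_eq0 (p : R) (q : \bar R) : (0 < q) ->
  (forall y, (0 < y)%R -> distr_fun A y = 0) \/ (forall y, (0 < y)%R -> distr_fun B y = 0) ->
  lorentz p q F = 0.
Proof.
move=> q0 AB0.
(* {G <> 0} is the union of the sets {|G| > 1/(k+1)} *)
have null (G : Rn R n -> \bar R) : (forall y, (0 < y)%R -> distr_fun G y = 0) ->
    leb R n [set x | 0 < `|G x|] = 0.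
  move=> G0.
  have -> : [set x | 0 < `|G x|] = \bigcup_k [set x | (k.+1%:R^-1)%:E < `|G x|].
    apply/seteqP; split => x /=.
      case E : (`|G x|) => [r||//]; last by move=> _; exists 0%N => //=; rewrite E ltry.
      rewrite lte_fin => r0; exists (Num.truncn r^-1) => //=; rewrite E lte_fin.
      by rewrite invf_plt ?posrE// truncnS_gt.
    by move=> [k _]; apply: le_lt_trans; rewrite lee_fin.
  by apply: leb_bigcup_eq0 => k; apply: G0.
have [M M0 MF] : exists2 M : set (Rn R n), leb R n M = 0 & forall x, ~ M x -> F x = 0.
  have h (G : Rn R n -> \bar R) : leb R n [set x | 0 < `|G x|] = 0 ->
      leb R n (N `|` [set x | 0 < `|G x|]) = 0.
    move=> G0; apply/eqP; rewrite eq_le; apply/andP; split.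
      by apply: le_trans (leb_le_setU _ _) _; rewrite N0 G0 adde0.
    exact: (outer_measure_ge0 ((borel_lebesgue R n)^*)%mu).
  case: AB0 => /null/h; set M := (_ `|` _) => M0; exists M => // x /not_orP[/FAB + /negP].
    move=> + G0; have -> : A x = 0.
      by apply/eqP; rewrite eq_le A0 andbT leNgt -(gee0_abs (A0 x)).
    rewrite poweR0r ?gt_eqF// mul0e mule0.
    by move=> Fx; apply/eqP; rewrite -abse_eq0 eq_le abse_ge0 andbT.
  move=> + G0; have -> : B x = 0.
    by apply/eqP; rewrite eq_le B0 andbT leNgt -(gee0_abs (B0 x)).
  rewrite poweR0r ?gt_eqF// mule0 mule0.
  by move=> Fx; apply/eqP; rewrite -abse_eq0 eq_le abse_ge0 andbT.
have F0 t : (0 < t)%R -> rearr F t = 0.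
  move=> t0; apply/eqP; rewrite eq_le rearr_ge0 andbT; apply/lee_addgt0Pr => e e0.
  rewrite add0e; apply: ereal_inf_lbound; exists e => //; split => //.
  apply: le_lt_trans (leb_le (B := M) _) _; last by rewrite M0 lte_fin.
  move=> x /=; apply: contraPP => /MF ->; rewrite abse0 lte_fin; apply/negP.
  by rewrite -leNgt ltW.
move: q q0 => [q||]//.
- rewrite lte_fin => q0; rewrite /lorentz integral0_eq.
    by rewrite poweR0r// invr_eq0 gt_eqF.
  move=> t; rewrite /= in_itv/= andbT => t0.
  by rewrite F0// mule0 poweR0r ?gt_eqF// mul0e.
- move=> _; rewrite /lorentz; apply/eqP; rewrite eq_le; apply/andP; split.
    by apply: ge_ereal_sup => _ [t t0 <-]; rewrite F0// mule0.
  by apply: ereal_sup_ubound; exists 1%R => //=; rewrite F0// mule0.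
Qed.

End geomean.

(** Uniform treatment of finite and infinite [q].  For finite [q], [X] is
    the q-th power of the normalized t^(1/p) A^*(t).  For q = +oo the
    normalized function is at most 1 and [X] is 0: the exponent of [X] is
    then 0, and 0^0 = 1. *)
Lemma lorentz_normalized (p : R) (q : \bar R) (A : Rn R n -> \bar R) (N : R) :
  (0 < p)%R -> 0 < q -> (0 < N)%R -> lorentz p q A = N%:E ->
  exists X : R -> R, [/\ forall t, (0 <= X t)%R,
    measurable_fun (`]0%R, +oo[%classic : set R) X,
    \int[lebesgue_measure]_(t in `]0%R, +oo[) (X t / t)%:E <= 1 &
    forall t e, (0 < t)%R -> (0 <= e)%R ->
      ((t `^ p^-1 * fine (rearr A t) / N) `^ e <= X t `^ (e * fine q^-1))%R].
Proof.
move=> p0 q0 N0 AN.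
have fin t : (0 < t)%R -> rearr A t = (fine (rearr A t))%:E.
  move=> t0; rewrite fineK// ge0_fin_numE ?rearr_ge0//.
  by apply: (lorentz_lty_rearr p0 q0 _ t0); rewrite AN ltry.
pose a t := (t `^ p^-1 * fine (rearr A t))%R.
have a0 t : (0 <= a t)%R by rewrite mulr_ge0 ?powR_ge0// fine_ge0// rearr_ge0.
have aN0 t : (0 <= a t / N)%R by rewrite divr_ge0// ltW.
have ma : measurable_fun (`]0%R, +oo[%classic : set R) a.
  apply: measurable_funM; first by apply: measurable_funTS; exact: measurable_powR.
  by apply: measurableT_comp => //; exact: measurable_rearr.
move: q q0 AN fin => [q||]// q0 AN fin.
- have {}q0 : (0 < q)%R by [].
  exists (fun t => (a t / N) `^ q)%R; split.
  + by move=> t; rewrite powR_ge0.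
  + apply: (@measurableT_comp _ _ _ _ _ _ (fun x : R => x `^ q)%R); first exact: measurable_powR.
    exact: measurable_funM.
  + have -> : \int[lebesgue_measure]_(t in `]0%R, +oo[) ((a t / N) `^ q / t)%:E =
        (N `^ (- q))%:E * \int[lebesgue_measure]_(t in `]0%R, +oo[)
              (((t `^ p^-1)%:E * rearr A t) `^ q * (t^-1)%:E).
      rewrite -ge0_integralZl//.
      * apply: eq_integral => t; rewrite inE/= in_itv/= andbT => t0.
        rewrite [rearr A t]fin// -(EFinM (t `^ p^-1)) poweR_EFin -!EFinM; congr EFin.
        rewrite powRM ?invr_ge0 ?(ltW N0)//; rewrite -powR_inv1 ?(ltW N0)// -powRrM mulN1r.
        by rewrite -/(a t) mulrAC mulrC mulrA.
      * apply: emeasurable_funM.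
          apply: (@measurableT_comp _ _ _ _ _ _ (fun x : \bar R => x `^ q)).
            exact: measurable_poweR.
          apply: emeasurable_funM; last exact: measurable_rearr.
          apply/measurable_EFinP; apply: measurable_funTS; exact: measurable_powR.
        by apply/measurable_EFinP; exact: measurable_invr_itv.
      * move=> t; rewrite /= in_itv/= andbT => t0.
        by rewrite mule_ge0 ?poweR_ge0// lee_fin invr_ge0 ltW.
      * by rewrite lee_fin powR_ge0.
    have := congr1 (fun z => z `^ q) AN; rewrite /lorentz -poweRrM mulVf ?gt_eqF//.
    rewrite poweRe1; last first.
      apply: integral_ge0 => t; rewrite /= in_itv/= andbT => t0.
      by rewrite mule_ge0 ?poweR_ge0// lee_fin invr_ge0 ltW.
    move=> ->; rewrite poweR_EFin -EFinM powRN mulVf// gt_eqF// powR_gt0//.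
  + move=> t e t0 e0; rewrite -/(a t).
    have -> : fine (q%:E)^-1 = q^-1%R by rewrite /inve gt_eqF.
    by rewrite -powRrM mulrCA mulfV ?gt_eqF// mulr1.
- exists (cst 0%R); split => //.
  + rewrite integral0_eq//. by move=> t _; rewrite mul0r.
  + move=> t e t0 e0; rewrite -/(a t).
    have -> : fine (+oo : \bar R)^-1 = 0%R by [].
    apply: (@le_trans _ _ (1 `^ e)%R); last by rewrite powR1 mulr0 powRr0.
    apply: ge0_ler_powR; rewrite ?nnegrE//.
    rewrite ler_pdivrMr// mul1r -lee_fin -AN; apply: ereal_sup_ubound.
    by exists t => //; rewrite EFinM -fin.
Qed.
End lorentz_hoelder.

Section hoelder_inequality.
Context (R : realType) (n : nat).
Local Open Scope ereal_scope.

Lemma lorentz_ge0 (p : R) (q : \bar R) (f : Rn R n -> \bar R) : 0 < q -> 0 <= lorentz p q f.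
Proof.
case: q => [q||]// _; first exact: poweR_ge0.
apply: (@le_trans _ _ ((1 `^ p^-1)%:E * rearr f 1)).
  by rewrite mule_ge0 ?rearr_ge0// lee_fin powR_ge0.
by apply: ereal_sup_ubound; exists 1%R => //=.
Qed.

Lemma inve_gt0E (q : \bar R) : 0 < q -> q^-1 = (fine q^-1)%:E /\ (0 <= fine q^-1)%R.
Proof.
case: q => [q||]//.
rewrite lte_fin /inve => q0; rewrite gt_eqF//=; split=> //; rewrite invr_ge0; exact: ltW.
Qed.

(** With both functions normalized, the integrand is at most
    X(t/2)^l1 Y(t/2)^l2 with l1 + l2 = 1, hence at most l1 X(t/2) + l2 Y(t/2),
    whose integral against dt/t is at most 1 by invariance under dilations. *)
Lemma lorentz_hoelder (th C p1 p2 p : R) (q1 q2 q : \bar R) :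
  (0 < th)%R -> (th < 1)%R -> (0 < C)%R -> (0 < p1)%R -> (0 < p2)%R ->
  (p^-1 = (1 - th) / p1 + th / p2)%R ->
  0 < q1 -> 0 < q2 -> q^-1 = (1 - th)%:E / q1 + th%:E / q2 ->
  exists c : R, forall (F A B : Rn R n -> \bar R) (N : set (Rn R n)),
    (forall x, 0 <= A x) -> (forall x, 0 <= B x) -> leb R n N = 0 ->
    (forall x, ~ N x -> `|F x| <= C%:E * (A x `^ (1 - th) * B x `^ th)) ->
    lorentz p q F <= c%:E * (lorentz p1 q1 A `^ (1 - th) * lorentz p2 q2 B `^ th).
Proof.
move=> th0 th1 C0 p10 p20 pE q10 q20 qE.
have th1' : (0 < 1 - th)%R by rewrite subr_gt0.
have p0 : (0 < p)%R by rewrite -invr_gt0 pE addr_gt0 ?divr_gt0.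
have [i1E i10] := inve_gt0E q10; have [i2E i20] := inve_gt0E q20.
set i1 := fine q1^-1 in i1E i10; set i2 := fine q2^-1 in i2E i20.
have {}qE : q^-1 = ((1 - th) * i1 + th * i2)%:E by rewrite qE i1E i2E -!EFinM.
have iq0 : (0 <= (1 - th) * i1 + th * i2)%R by apply: addr_ge0; apply: mulr_ge0 => //; exact: ltW.
have q0 : 0 < q.
  move: qE; case: (q) => [r||]//.
  rewrite /inve; case: ifPn => // r0 [rE]; rewrite lte_fin -invr_gt0 rE.
  by rewrite lt_neqAle iq0 andbT eq_sym -rE invr_eq0.
(* 2^(1/p) is lost by evaluating the rearrangements at t/2 *)
pose c := (2 * C * 2 `^ p^-1)%R.
have c0 : (0 < c)%R by rewrite !mulr_gt0// powR_gt0.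
exists c => F A B N A0 B0 N0 FAB.
have LA0 := lorentz_ge0 p1 A q10; have LB0 := lorentz_ge0 p2 B q20.
have RHS0 : 0 <= c%:E * (lorentz p1 q1 A `^ (1 - th) * lorentz p2 q2 B `^ th).
  by rewrite mule_ge0 ?lee_fin ?(ltW c0)// mule_ge0 ?poweR_ge0.
have [LA|LA] := eqVneq (lorentz p1 q1 A) 0.
  rewrite (lorentz_geomean_eq0 th0 th1 A0 B0 N0 FAB p q0)//; left.
  by apply: distr_fun_rearr_eq0 => t; apply: lorentz_eq0_rearr LA.
have [LB|LB] := eqVneq (lorentz p2 q2 B) 0.
  rewrite (lorentz_geomean_eq0 th0 th1 A0 B0 N0 FAB p q0)//; right.
  by apply: distr_fun_rearr_eq0 => t; apply: lorentz_eq0_rearr LB.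
have {}LA0 : 0 < lorentz p1 q1 A by rewrite lt_neqAle eq_sym LA.
have {}LB0 : 0 < lorentz p2 q2 B by rewrite lt_neqAle eq_sym LB.
have [LAy|LAy] := eqVneq (lorentz p1 q1 A) +oo.
  by rewrite LAy poweRyr ?gt_eqF// gt0_mulye ?poweR_gt0// gt0_muley ?leey// lte_fin.
have [LBy|LBy] := eqVneq (lorentz p2 q2 B) +oo.
  by rewrite LBy poweRyr ?gt_eqF// gt0_muley ?poweR_gt0// gt0_muley ?leey// lte_fin.
have [NA AN] : exists a : R, lorentz p1 q1 A = a%:E.
  by case: (lorentz p1 q1 A) LA0 LAy => [a||]//; exists a.
have [NB BN] : exists b : R, lorentz p2 q2 B = b%:E.
  by case: (lorentz p2 q2 B) LB0 LBy => [a||]//; exists a.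
have NA0 : (0 < NA)%R by rewrite -lte_fin -AN.
have NB0 : (0 < NB)%R by rewrite -lte_fin -BN.
have [X [X0 mX XI XP]] := lorentz_normalized p10 q10 NA0 AN.
have [Y [Y0 mY YI YP]] := lorentz_normalized p20 q20 NB0 BN.
rewrite AN BN !poweR_EFin -!EFinM.
set K := (c * _)%R.
have K0 : (0 < K)%R by rewrite !mulr_gt0// powR_gt0.
pose a t := (t `^ p1^-1 * fine (rearr A t) / NA)%R.
pose b t := (t `^ p2^-1 * fine (rearr B t) / NB)%R.
have a0 t : (0 <= a t)%R.
  by rewrite divr_ge0 ?(ltW NA0)// mulr_ge0 ?powR_ge0// fine_ge0// rearr_ge0.
have b0 t : (0 <= b t)%R.
  by rewrite divr_ge0 ?(ltW NB0)// mulr_ge0 ?powR_ge0// fine_ge0// rearr_ge0.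
have key t : (0 < t)%R ->
    (t `^ p^-1)%:E * rearr F t <= (K * (a (t / 2) `^ (1 - th) * b (t / 2) `^ th))%:E.
  move=> t0; have t20 : (0 < t / 2)%R by rewrite divr_gt0.
  have Ay : rearr A (t / 2) < +oo by apply: (lorentz_lty_rearr p10 q10 _ t20); rewrite AN ltry.
  have By : rearr B (t / 2) < +oo by apply: (lorentz_lty_rearr p20 q20 _ t20); rewrite BN ltry.
  have tp : (0 <= t `^ p^-1)%R by rewrite powR_ge0.
  have := rearr_geomean th0 th1 C0 A0 B0 N0 FAB Ay By.
  move=> /(lee_wpmul2l (x := (t `^ p^-1)%:E)); rewrite lee_fin => /(_ tp) /le_trans; apply.
  rewrite -EFinM lee_fin /a /b; set fa := fine _; set fb := fine _.
  have fa0 : (0 <= fa)%R by rewrite fine_ge0// rearr_ge0.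
  have fb0 : (0 <= fb)%R by rewrite fine_ge0// rearr_ge0.
  have -> : (t `^ p^-1 = 2 `^ p^-1 * ((t / 2) `^ (p1^-1 * (1 - th)) * (t / 2) `^ (p2^-1 * th)))%R.
    rewrite -powRD; last by apply/implyP => _; rewrite gt_eqF.
    rewrite (mulrC p1^-1%R) (mulrC p2^-1%R) -pE -powRM ?(ltW t20)// mulrC divfK//.
  have := ltW t20; move: (t / 2)%R fa fb fa0 fb0 => s fa fb fa0 fb0 s0.
  rewrite !powRM ?mulr_ge0 ?powR_ge0 ?invr_ge0 ?(ltW NA0) ?(ltW NB0)//.
  rewrite -(powR_inv1 (ltW NA0)) -(powR_inv1 (ltW NB0)) -!powRrM !mulN1r.
  rewrite /K /c !powRN.
  have : (NA `^ (1 - th) != 0)%R by rewrite gt_eqF// powR_gt0.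
  have : (NB `^ th != 0)%R by rewrite gt_eqF// powR_gt0.
  move: (NA `^ (1 - th))%R (NB `^ th)%R => u v u0 v0.
  rewrite le_eqVlt; apply/orP; left; apply/eqP; field. by rewrite u0 v0.
case: q q0 qE => [q||]// q0 qE.
- have {}q0 : (0 < q)%R by [].
  have {}qE : (q^-1 = (1 - th) * i1 + th * i2)%R by move: qE; rewrite /inve gt_eqF// => -[].
  pose l1 := ((1 - th) * q * i1)%R; pose l2 := (th * q * i2)%R.
  have l12 : (l1 + l2 = 1)%R.
    have -> : (l1 + l2 = q * ((1 - th) * i1 + th * i2))%R by rewrite /l1 /l2; ring.
    by rewrite -qE mulfV// gt_eqF.
  have l10 : (0 <= l1)%R by rewrite !mulr_ge0// ltW.
  have l20 : (0 <= l2)%R by rewrite !mulr_ge0// ltW.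
  have mg (Z : R -> R) : measurable_fun (`]0%R, +oo[%classic : set R) Z ->
      measurable_fun (`]0%R, +oo[%classic : set R) (fun t => Z (2^-1 * t))%R.
    move=> mZ; apply: (@measurable_comp _ _ _ R R R `]0%R, +oo[%classic Z `]0%R, +oo[%classic (fun t => 2^-1 * t)%R).
    + exact: measurable_itv.
    + by move=> _ [t /= t0 <-]; move: t0; rewrite !in_itv/= !andbT => t0; rewrite mulr_gt0.
    + exact: mZ.
    + by apply: measurable_funTS; exact: mulrl_measurable.
  have mh (Z : R -> R) : measurable_fun (`]0%R, +oo[%classic : set R) Z ->
      measurable_fun (`]0%R, +oo[%classic : set R) (fun t => (Z (2^-1 * t) / t)%:E)%R.
    move=> mZ; apply/measurable_EFinP; apply: measurable_funM; last exact: measurable_invr_itv.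
    exact: mg.
  have pt (Z : R -> R) (l : R) : (forall t, 0 <= Z t)%R -> (0 <= l)%R -> forall t,
     (`]0%R, +oo[%classic : set R) t -> 0 <= l%:E * (Z (2^-1 * t) / t)%:E.
    move=> Z0 l0 t; rewrite /= in_itv/= andbT => t0.
    by rewrite mule_ge0// lee_fin// divr_ge0// ltW.
  have I : \int[lebesgue_measure]_(t in `]0%R, +oo[)
      (((t `^ p^-1)%:E * rearr F t) `^ q * (t^-1)%:E) <= (K `^ q)%:E.
    apply: (@le_trans _ _ (\int[lebesgue_measure]_(t in `]0%R, +oo[)
      ((K `^ q)%:E * (l1%:E * (X (2^-1 * t) / t)%:E + l2%:E * (Y (2^-1 * t) / t)%:E)))).
      apply: ge0_le_integral_nomeas => t; rewrite /= in_itv/= andbT => t0.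
        by rewrite mule_ge0 ?poweR_ge0// lee_fin invr_ge0 ltW.
      apply: (@le_trans _ _ ((K * (a (t / 2) `^ (1 - th) * b (t / 2) `^ th))%:E `^ q * (t^-1)%:E)).
        rewrite lee_wpmul2r ?lee_fin ?invr_ge0 ?(ltW t0)//.
        apply: lee_poweR (key _ t0); first exact: ltW.
        by rewrite mule_ge0 ?rearr_ge0// lee_fin powR_ge0.
      rewrite poweR_EFin -EFinM.
      rewrite -[leRHS]/((K `^ q * (l1 * (X (2^-1 * t) / t) + l2 * (Y (2^-1 * t) / t)))%:E).
      rewrite lee_fin.
      rewrite (@powRM _ K) ?(ltW K0)//; last by rewrite mulr_ge0 ?powR_ge0.
      rewrite -[leLHS]mulrA ler_wpM2l ?powR_ge0//.
      rewrite !mulrA -mulrDl ler_wpM2r ?invr_ge0 ?(ltW t0)//.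
      rewrite powRM ?powR_ge0// -!powRrM (mulrC 2^-1%R t).
      apply: le_trans (weighted_amgm (X0 _) (Y0 _) l10 l20 l12).
      apply: ler_pM; rewrite ?powR_ge0//.
      + by apply: XP; rewrite ?divr_gt0// mulr_ge0// ltW.
      + by apply: YP; rewrite ?divr_gt0// mulr_ge0// ltW.
    rewrite ge0_integralZl//; last 3 first.
    + by apply: emeasurable_funD; apply: emeasurable_funM => //; exact: mh.
    + by move=> t tp; apply: adde_ge0; apply: pt.
    + by rewrite lee_fin powR_ge0.
    rewrite -[leRHS]mule1 lee_wpmul2l ?lee_fin ?powR_ge0//.
    rewrite ge0_integralD//; last 4 first.
    + by move=> t; apply: pt.
    + by apply: emeasurable_funM => //; exact: mh.
    + by move=> t; apply: pt.
    + by apply: emeasurable_funM => //; exact: mh.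
    rewrite !ge0_integralZl//; last 4 first.
    + exact: mh.
    + by move=> t tp; have := pt Y 1%R Y0 ler01 t tp; rewrite mul1e.
    + exact: mh.
    + by move=> t tp; have := pt X 1%R X0 ler01 t tp; rewrite mul1e.
    rewrite !ge0_integral_dilation//.
    rewrite -l12 EFinD; apply: leeD.
    + by rewrite -[leRHS]mule1 lee_wpmul2l// lee_fin.
    + by rewrite -[leRHS]mule1 lee_wpmul2l// lee_fin.
  rewrite /lorentz; apply: le_trans (lee_poweR _ _ I) _.
  + by rewrite invr_ge0 ltW.
  + apply: integral_ge0 => t; rewrite /= in_itv/= andbT => t0.
    by rewrite mule_ge0 ?poweR_ge0// lee_fin invr_ge0 ltW.
  by rewrite poweR_EFin -powRrM mulfV ?gt_eqF// powRr1 ?(ltW K0).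
- have := qE; rewrite /inve => -[] /esym/eqP; rewrite paddr_eq0 ?mulr_ge0 ?(ltW th1') ?(ltW th0)//.
  rewrite !mulf_eq0 (gt_eqF th1') (gt_eqF th0) /= => /andP[/eqP i10' /eqP i20'].
  rewrite /lorentz; apply: ge_ereal_sup => _ [t t0 <-].
  apply: le_trans (key t t0) _; rewrite lee_fin -[leRHS]mulr1 ler_wpM2l ?(ltW K0)//.
  have t20 : (0 < t / 2)%R by rewrite divr_gt0.
  rewrite -[leRHS]mulr1; apply: ler_pM; rewrite ?powR_ge0//.
  + by have := XP _ (1 - th)%R t20 (ltW th1'); rewrite -/i1 i10' mulr0 powRr0.
  + by have := YP _ th t20 (ltW th0); rewrite -/i2 i20' mulr0 powRr0.
Qed.
End hoelder_inequality.

(** * Lebesgue measure and Gaussian integrals on R^n *)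

Section borel_lebesgue_theory.
Context (R : realType).
Local Open Scope ereal_scope.

Notation T n := (n.-tuple (measurableTypeR R)).
Notation mu n := (borel_lebesgue R n).

Lemma integral_borel_lebesgueS n (phi : T n.+1 -> \bar R) :
  measurable_fun setT phi -> (forall x, 0 <= phi x) ->
  \int[mu n.+1]_x phi x =
  \int[lebesgue_measure]_a \int[mu n]_t phi [the T n.+1 of a :: t].
Proof.
move=> mphi phi0.
pose pf : {measure set (T n.+1) -> \bar R} :=
  pushforward (lebesgue_measure \x mu n)%E (@tcons R n).
transitivity (\int[pf (@measurable_tcons R n)]_x phi x); first by [].
rewrite ge0_integral_pushforward//; last exact: measurable_tcons.
rewrite preimage_setT.
have mpt : measurable_fun setT (phi \o @tcons R n).
  by apply: measurableT_comp => //; exact: measurable_tcons.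
exact: (fubini_tonelli1 (phi \o @tcons R n) mpt (fun z => phi0 (tcons z))).
Qed.

(** The subtraction [sub_Rn], on the type that carries the Borel sets. *)
Definition subT n (x y : T n) : T n := [tuple (tnth x i - tnth y i)%R | i < n].

Lemma subT_cons n (a b : R) (x y : T n) :
  subT [the T n.+1 of a :: x] [the T n.+1 of b :: y] =
  [the T n.+1 of (a - b)%R :: subT x y].
Proof.
apply: eq_from_tnth => i; rewrite tnth_mktuple.
case: (unliftP ord0 i) => [j ->|->]; last by rewrite !tnth0.
by rewrite !tnthS tnth_mktuple.
Qed.

Lemma measurable_subT n : measurable_fun setT (fun z : T n * T n => subT z.1 z.2).
Proof.
apply/measurable_fun_tnthP => i.
rewrite (_ : _ \o _ = (fun z : T n * T n => tnth z.1 i - tnth z.2 i)%R); last first.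
  by apply/funext => z /=; rewrite tnth_mktuple.
apply: measurable_funB.
  by apply: (measurableT_comp (measurable_tnth i)).
by apply: (measurableT_comp (measurable_tnth i)).
Qed.

Lemma measurable_subTr n (x : T n) : measurable_fun setT (subT x).
Proof.
apply: (measurableT_comp (@measurable_subT n) (f := fun z => subT z.1 z.2) (g := pair x)).
exact: pair1_measurable.
Qed.

Lemma measurable_subTl n (y : T n) : measurable_fun setT (fun x : T n => subT x y).
Proof.
apply: (measurableT_comp (@measurable_subT n) (f := fun z => subT z.1 z.2) (g := pair^~ y)).
exact: pair2_measurable.
Qed.

(** Both measures agree on bounded intervals, where they are lengths. *)
Lemma ge0_integral_reflect1 (c : R) (phi : R -> \bar R) : measurable_fun setT phi ->
  (forall x, 0 <= phi x) ->
  \int[lebesgue_measure]_x phi (c - x)%R = \int[lebesgue_measure]_x phi x.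
Proof.
move=> mphi phi0.
have mc : measurable_fun [set: measurableTypeR R] (fun x : measurableTypeR R => (c - x)%R : measurableTypeR R).
  exact: measurable_funB.
pose pf : {measure set (measurableTypeR R) -> \bar R} :=
  pushforward lebesgue_measure (fun x : measurableTypeR R => (c - x)%R : measurableTypeR R).
transitivity (\int[pf mc]_x phi x).
  by rewrite ge0_integral_pushforward.
apply: eq_measure_integral => A mA _; apply/esym; apply: lebesgue_measure_unique mA.
move=> _ [[a b]] _ <-.
rewrite -[RHS]/(lebesgue_measure ((fun x : R => c - x)%R @^-1` `]a, b]%classic : set R)).
rewrite [X in _ = lebesgue_measure X](_ : _ = `[c - b, c - a[%classic)%R; last first.
  apply/seteqP; split => x; rewrite /= !in_itv/= => /andP[h1 h2]; apply/andP; split; lra.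
rewrite !lebesgue_measure_itv/= !lte_fin ltrD2l ltrN2.
by case: ifPn => // _; rewrite -!EFinD; congr EFin; ring.
Qed.

(** By induction on the dimension, one coordinate at a time. *)
Lemma ge0_integral_reflect n (x : T n) (phi : T n -> \bar R) : measurable_fun setT phi ->
  (forall x, 0 <= phi x) ->
  \int[mu n]_y phi (subT x y) = \int[mu n]_y phi y.
Proof.
elim: n x phi => [|n IH] x phi mphi phi0.
  by apply: eq_integral => y _; congr phi; apply: eq_from_tnth => -[].
rewrite !integral_borel_lebesgueS//; last first.
  by apply: measurableT_comp => //; exact: measurable_subTr.
case/tupleP : x => a x.
transitivity (\int[lebesgue_measure]_b (\int[mu n]_t phi [the T n.+1 of (a - b)%R :: t])).
  apply: eq_integral => b _.
  rewrite -(IH x (fun t => phi [the T n.+1 of (a - b)%R :: t]))//.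
    by apply: eq_integral => t _; rewrite -subT_cons.
  by apply: measurableT_comp => //; exact: measurable_cons.
apply: (ge0_integral_reflect1 a (phi := fun b => \int[mu n]_t phi [the T n.+1 of b :: t])).
  apply: (@measurable_fun_fubini_tonelli_F _ _ _ _ _ (mu n) (fun z => phi (tcons z))) => //.
  by apply: measurableT_comp => //; exact: measurable_tcons.
by move=> b; apply: integral_ge0.
Qed.

(** A translation is the composition of two reflections. *)
Lemma ge0_integral_translate n (y : T n) (phi : T n -> \bar R) : measurable_fun setT phi ->
  (forall x, 0 <= phi x) ->
  \int[mu n]_x phi (subT x y) = \int[mu n]_x phi x.
Proof.
move=> mphi phi0; pose o : T n := [tuple 0%R | i < n].
rewrite -(ge0_integral_reflect o (phi := fun x => phi (subT x y)))//; last first.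
  by apply: measurableT_comp => //; exact: measurable_subTl.
rewrite -(ge0_integral_reflect (subT o y) (phi := phi))//.
apply: eq_integral => x _; congr phi; apply: eq_from_tnth => i.
by rewrite !tnth_mktuple; ring.
Qed.

Lemma ge0_integral_prod n (g : R -> R) : measurable_fun setT g ->
  (forall a, (0 <= g a)%R) -> forall c : R,
  \int[lebesgue_measure]_a (g a)%:E = c%:E ->
  \int[mu n]_x (\prod_(i < n) g (tnth x i))%:E = (c ^+ n)%:E.
Proof.
move=> mg g0 c Ic; have mprod k : measurable_fun setT (fun x : T k => (\prod_(i < k) g (tnth x i))%:E).
  apply/measurable_EFinP; apply: measurable_prod => i _.
  by apply: measurableT_comp => //; exact: measurable_tnth.
elim: n => [|n IH].
  rewrite integral_dirac//; last exact: mprod.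
  by rewrite diracT mul1e big_ord0 expr0.
rewrite integral_borel_lebesgueS//; last first.
  by move=> x; rewrite lee_fin prodr_ge0.
transitivity (\int[lebesgue_measure]_a ((g a)%:E * (c ^+ n)%:E)).
  apply: eq_integral => a _; rewrite -IH -ge0_integralZl//.
  - apply: eq_integral => x _; rewrite -EFinM big_ord_recl tnth0; congr (_ * _)%:E%R.
    by apply: eq_bigr => i _; rewrite tnthS.
  - exact: mprod.
  - by move=> x _; rewrite lee_fin prodr_ge0.
  - by rewrite lee_fin.
have c0 : (0 <= c)%R by rewrite -lee_fin -Ic integral_ge0// => a _; rewrite lee_fin.
rewrite ge0_integralZr//.
- by rewrite Ic -EFinM exprS.
- exact/measurable_EFinP.
- by move=> a _; rewrite lee_fin.
- by rewrite lee_fin exprn_ge0.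
Qed.

(** A dilation of the standard Gaussian integral. *)
Lemma integral_gauss_scaled (h : R) : (0 < h)%R ->
  \int[lebesgue_measure]_a (expR (- a ^+ 2 / (4 * h)))%:E = ((4 * pi * h) `^ 2^-1)%:E.
Proof.
move=> h0; pose k := (Num.sqrt (4 * h))^-1%R.
have k0 : (0 < k)%R by rewrite invr_gt0 sqrtr_gt0 mulr_gt0.
have mg : measurable_fun setT (EFin \o gauss_fun : R -> \bar R).
  by apply/measurable_EFinP; exact: measurable_gauss_fun.
have := ge0_integral_scale k0 mg (fun x => gauss_fun_ge0 x).
rewrite integralT_gauss.
have -> : \int[lebesgue_measure]_x (EFin \o gauss_fun) (k * x)%R =
    \int[lebesgue_measure]_a (expR (- a ^+ 2 / (4 * h)))%:E.
  apply: eq_integral => a _ /=; congr (expR _)%:E.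
  by rewrite exprMn exprVn sqr_sqrtr ?mulr_ge0 ?ltW// mulNr mulrC.
move=> /(congr1 (fun z => (k^-1)%:E * z)); rewrite muleA -!EFinM mulVf ?gt_eqF// mul1e.
move=> <-; rewrite invrK -sqrtrM ?mulr_ge0 ?ltW//.
rewrite -powR12_sqrt ?mulr_ge0 ?pi_ge0 ?ltW//; congr (_ `^ _)%:E%R; ring.
Qed.

Lemma heat_kernelE n (h : R) (y : T n) :
  heat_kernel h (y : Rn R n) =
  ((4 * pi * h) `^ (- (n%:R / 2)) * \prod_(i < n) expR (- tnth y i ^+ 2 / (4 * h)))%R.
Proof.
rewrite /heat_kernel; congr (_ * _)%R; rewrite -expR_sum; congr expR.
by rewrite -mulr_suml sumrN.
Qed.

Lemma heat_kernel_gt0 n (h : R) (y : Rn R n) : (0 < h)%R -> (0 < heat_kernel h y)%R.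
Proof.
by move=> h0; rewrite mulr_gt0 ?expR_gt0// powR_gt0// !mulr_gt0// pi_gt0.
Qed.

Lemma measurable_heat_kernel n (h : R) :
  measurable_fun setT (fun y : T n => heat_kernel h (y : Rn R n)).
Proof.
under eq_fun do rewrite heat_kernelE.
apply: measurable_funM => //; apply: measurable_prod => i _.
apply: measurableT_comp; first exact: measurable_expR.
apply: measurable_funM => //; apply: measurableT_comp => //.
by apply: measurable_funX; exact: measurable_tnth.
Qed.

Lemma integral_heat_kernel n (h : R) : (0 < h)%R ->
  \int[mu n]_y (heat_kernel h (y : Rn R n))%:E = 1.
Proof.
move=> h0; have h40 : (0 < 4 * pi * h)%R by rewrite !mulr_gt0// pi_gt0.
under eq_integral do rewrite heat_kernelE EFinM.
rewrite ge0_integralZl//.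
- have mg : measurable_fun setT (fun a : R => expR (- a ^+ 2 / (4 * h))).
    apply: measurableT_comp; first exact: measurable_expR.
    by apply: measurable_funM => //; apply: measurableT_comp.
  rewrite (@ge0_integral_prod n _ mg (fun a => expR_ge0 _) _ (integral_gauss_scaled h0)).
  rewrite -EFinM -powR_mulrn ?powR_ge0// -powRrM -powRD; last first.
    by apply/implyP => _; rewrite gt_eqF.
  by rewrite (_ : - (n%:R / 2) + 2^-1 * n%:R = 0)%R ?powRr0//; ring.
- apply/measurable_EFinP; apply: measurable_prod => i _.
  apply: measurableT_comp; first exact: measurable_expR.
  apply: measurable_funM => //; apply: measurableT_comp => //.
  by apply: measurable_funX; exact: measurable_tnth.
- by move=> x _; rewrite lee_fin prodr_ge0// => i _; rewrite expR_ge0.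
- by rewrite lee_fin powR_ge0.
Qed.

End borel_lebesgue_theory.

(** * Borel representatives of Lebesgue measurable functions *)

Section completion.
Context d (T : measurableType d) (R : realType).
Variable mu : {sigma_finite_measure set T -> \bar R}.
Local Open Scope ereal_scope.

Lemma measure_bigcup_eq0 (A : (set T)^nat) : (forall i, measurable (A i)) ->
  (forall i, mu (A i) = 0) -> mu (\bigcup_i A i) = 0.
Proof.
move=> mA A0; have mU : measurable (\bigcup_i A i) by exact: bigcupT_measurable.
apply/eqP; rewrite eq_le measure_ge0 andbT.
have : mu (\bigcup_i A i) <= \sum_(i <oo) mu (A i).
  exact: measure_sigma_subadditive.
by rewrite eseries0.
Qed.

(** The intersection of covers whose measures approach the outer measure. *)
Lemma measurable_hull (X : set T) :
  exists B, [/\ measurable B, X `<=` B & mu B = (mu^*)%mu X].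
Proof.
have [Xy|Xy] := eqVneq ((mu^*)%mu X) +oo.
  exists setT; split => //; apply/eqP; rewrite Xy -leye_eq -Xy.
  by rewrite -(measurable_mu_extE mu)//; apply: le_mu_ext.
have Xf : (mu^*)%mu X \is a fin_num.
  by rewrite ge0_fin_numE ?ltey// mu_ext_ge0.
have H k : exists U, [/\ measurable U, X `<=` U & mu U <= (mu^*)%mu X + k.+1%:R^-1%:E].
  have k0 : (0 < k.+1%:R^-1 :> R)%R by rewrite invr_gt0.
  have [_ [F [mF XF] <-] lt] := lb_ereal_inf_adherent k0 Xf.
  exists (\bigcup_i F i); split => //; first exact: bigcupT_measurable.
  apply: le_trans (ltW lt); apply: measure_sigma_subadditive => //.
  exact: bigcupT_measurable.
have {H}[U HU] := choice H.
exists (\bigcap_k U k); split.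
- by apply: bigcapT_measurable => k; have [] := HU k.
- by move=> x Xx k _; have [_ XU _] := HU k; exact: XU.
have mB : measurable (\bigcap_k U k) by apply: bigcapT_measurable => k; have [] := HU k.
apply/eqP; rewrite eq_le; apply/andP; split.
  apply/lee_addgt0Pr => e e0.
  have [k ke] : exists k, (k.+1%:R^-1 <= e :> R)%R.
    exists (Num.truncn e^-1); apply/ltW; rewrite invf_plt ?posrE//; exact: truncnS_gt.
  have [mU _ Ule] := HU k.
  apply: (@le_trans _ _ (mu (U k))).
    by apply: le_measure; rewrite ?inE//; exact: bigcap_inf.
  by apply: le_trans Ule _; rewrite leeD2l// lee_fin.
rewrite -(measurable_mu_extE mu)//; apply: le_mu_ext.
by move=> x Xx k _; have [_ XU _] := HU k; exact: XU.
Qed.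

(** In each piece of finite measure, [B] is a hull of A and [M] a hull of
    B \ A, which is null because A is Caratheodory measurable. *)
Lemma caratheodory_borel_mod_null (A : set T) : (mu^*)%mu.-cara.-measurable A ->
  exists B M, [/\ measurable B, measurable M, mu M = 0 & A `\` M = B `\` M].
Proof.
move=> cA; have /sigma_finiteP[F [TF _ Foo]] := sigma_finiteT mu.
have mF i : measurable (F i) by have [] := Foo i.
have H i : exists BM : set T * set T, [/\ measurable BM.1, measurable BM.2,
    mu BM.2 = 0, A `&` F i `<=` BM.1 & BM.1 `\` (A `&` F i) `<=` BM.2].
  have [B [mB AB muB]] := measurable_hull (A `&` F i).
  pose D := B `\` (A `&` F i).
  have cAF : (mu^*)%mu.-cara.-measurable (A `&` F i).
    by apply: measurableI => //; apply: caratheodory_measurable_mu_ext.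
  have fin : (mu^*)%mu (A `&` F i) < +oo.
    apply: le_lt_trans (le_mu_ext mu (@subIsetr _ A (F i))) _.
    by rewrite measurable_mu_extE//; have [] := Foo i.
  have D0 : (mu^*)%mu D = 0.
    have BE : (mu^*)%mu B = (mu^*)%mu (A `&` F i) by rewrite -muB; exact: measurable_mu_extE.
    have E : (mu^*)%mu B = (mu^*)%mu (B `&` (A `&` F i)) + (mu^*)%mu (B `&` ~` (A `&` F i)).
      exact: cAF.
    rewrite BE (setIidr AB) in E.
    have : (mu^*)%mu (A `&` F i) \is a fin_num by rewrite ge0_fin_numE// mu_ext_ge0.
    move: E; rewrite -/D; case: ((mu^*)%mu (A `&` F i)) => [r||]//.
    rewrite -setDE -/D; case: ((mu^*)%mu D) => [s||]//.
    by rewrite -EFinD => -[] rs _; congr EFin; lra.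
  have [M [mM DM muM]] := measurable_hull D.
  exists (B, M); split => //=; first by rewrite muM.
have {H}[BM HBM] := choice H.
exists (\bigcup_i ((BM i).1 `&` F i)), (\bigcup_i (BM i).2); split.
- by apply: bigcupT_measurable => i; apply: measurableI => //; have [] := HBM i.
- by apply: bigcupT_measurable => i; have [] := HBM i.
- by apply: measure_bigcup_eq0 => i; have [] := HBM i.
apply/seteqP; split => x [Ax Mx]; split => //.
  have [i _ Fx] : (\bigcup_i F i) x by rewrite -TF.
  by exists i => //; split => //; have [_ _ _ h _] := HBM i; apply: h.
case: Ax => i _ [Bx Fx]; apply: contrapT => nA; apply: Mx; exists i => //.
by have [_ _ _ _ h] := HBM i; apply: h; split => // -[/nA].
Qed.

(** The countably many sets {q < f}, q rational, are Borel up to null sets,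
    and these determine f; replacing f by 0 on a Borel null set that contains
    all the exceptional sets makes it a Borel function. *)
Lemma caratheodory_measurable_fun_borel (M0 : set T)
    (f : caratheodory_type (mu^*)%mu -> R) : (mu^*)%mu M0 = 0 ->
  measurable_fun setT f ->
  exists M : set T, [/\ measurable M, mu M = 0, M0 `<=` M &
    measurable_fun setT (fun x : T => if x \in M then 0%R else f x)].
Proof.
move=> M00 mf.
have H (q : rat) : exists BM : set T * set T, [/\ measurable BM.1, measurable BM.2,
    mu BM.2 = 0 & [set x | (ratr q < f x)%R] `\` BM.2 = BM.1 `\` BM.2].
  have : (mu^*)%mu.-cara.-measurable (setT `&` f @^-1` `](ratr q : R), +oo[%classic).
    exact: mf.
  rewrite setTI => /caratheodory_borel_mod_null[B [M [mB mM muM E]]]; exists (B, M); split => //=.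
  rewrite -E; congr (_ `\` _); apply/seteqP; split => x /=; rewrite in_itv/= andbT//.
have {H}[BM HBM] := choice H.
have [N [mN M0N muN]] := measurable_hull M0.
(* an enumeration of the rationals *)
pose rt (k : nat) : rat := odflt 0%R (unpickle k).
have rtK q : rt (pickle q) = q by rewrite /rt pickleK.
pose M := N `|` \bigcup_k (BM (rt k)).2.
have mBM k : measurable (BM (rt k)).2 by have [] := HBM (rt k).
have mM : measurable M by apply: measurableU => //; exact: bigcupT_measurable.
exists M; split => //.
- apply/eqP; rewrite eq_le measure_ge0 andbT.
  apply: (@le_trans _ _ (mu N + mu (\bigcup_k (BM (rt k)).2))).
    by apply: measureU2 => //; exact: bigcupT_measurable.
  rewrite muN M00 add0e.
  by rewrite measure_bigcup_eq0// => k; have [] := HBM (rt k).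
- by move=> x /M0N Nx; left.
apply: (measurability _ (RGenOInfty.measurableE R)) => // _ [_ [y ->] <-].
rewrite setTI.
rewrite (_ : _ @^-1` _ = (\bigcup_k ((if (y < ratr (rt k))%R then (BM (rt k)).1 else set0) `\` M))
   `|` (if (y < 0)%R then M else set0)).
  apply: measurableU; last by case: ifP.
  apply: bigcupT_measurable => k; apply: measurableD => //.
  by case: ifP => // _; have [] := HBM (rt k).
apply/seteqP; split => x.
  rewrite /= in_itv/= andbT; case: ifPn => [/set_mem Mx y0|/negP Mx yf].
    by right; rewrite y0.
  have [q] := rat_in_itvoo yf; rewrite in_itv/= => /andP[yq qf].
  have nM : ~ M x by move=> /mem_set.
  left; exists (pickle q) => //=; rewrite rtK yq; split => //.
  have [_ _ _ E] := HBM q.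
  have : ([set x | (ratr q < f x)%R] `\` (BM q).2) x.
    split => // h; apply: nM; right; exists (pickle q) => //=; by rewrite rtK.
  by rewrite E => -[].
rewrite /= in_itv/= andbT => -[[k _]|]; last first.
  case: ifP => // y0 Mx; by rewrite mem_set.
case: ifP => [yk [Bx Mx]|_ []//].
rewrite memNset//; apply: lt_trans yk _.
have [_ _ _ E] := HBM (rt k).
have : ((BM (rt k)).1 `\` (BM (rt k)).2) x.
  by split => // h; apply: Mx; right; exists k.
by rewrite -E => -[].
Qed.

End completion.

Lemma integral_norm_add_indic d (T : measurableType d) (R : realType)
    (mu : {measure set T -> \bar R}) (g : T -> R) (K : R) (E : set T) :
  (0 <= K)%R -> measurable E -> (mu E < +oo)%E -> mu.-integrable setT (EFin \o g) ->
  (\int[mu]_x (`|(EFin \o g) x| + K%:E * (\1_E x)%:E) < +oo)%E.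
Proof.
move=> K0 mE Efin /integrableP[mg gfin].
have mi : measurable_fun setT (fun x => (\1_E x)%:E : \bar R).
  by apply/measurable_EFinP; exact: measurable_indic.
rewrite ge0_integralD//.
- rewrite lte_add_pinfty// ge0_integralZl//.
  by rewrite integral_indic// setIT lte_mul_pinfty// lee_fin.
- exact: measurableT_comp.
- by move=> x _; rewrite mule_ge0// lee_fin.
- by apply: emeasurable_funM.
Qed.

Section representative.
Context (R : realType) (n : nat).
Local Open Scope ereal_scope.
Notation T := (n.-tuple (measurableTypeR R)).
Notation mu := (borel_lebesgue R n).
Notation leb := (leb R n).

Lemma borel_measurable_Rn (A : set T) : measurable A -> measurable (A : set (Rn R n)).
Proof. by move=> mA; exact: caratheodory_measurable_mu_ext. Qed.

Lemma leb_borel (A : set T) : measurable A -> leb A = mu A.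
Proof. exact: measurable_mu_extE. Qed.

Lemma borel_measurable_fun d (U : measurableType d) (f : T -> U) :
  measurable_fun setT f -> measurable_fun setT (f : Rn R n -> U).
Proof. by move=> mf _ B mB; apply: borel_measurable_Rn; exact: mf. Qed.

Lemma leb_complete : measure_is_complete leb.
Proof. exact: measure_is_complete_caratheodory. Qed.

(** Borel functions have the same integral for the completed measure, whose
    image under the identity map is the Borel one. *)
Lemma ge0_integral_leb (f : T -> \bar R) : measurable_fun setT f ->
  (forall x, 0 <= f x) -> \int[leb]_x f x = \int[mu]_x f x.
Proof.
move=> mf f0.
have mid : measurable_fun [set: Rn R n] (id : Rn R n -> T).
  by move=> _ B mB; rewrite setTI; exact: borel_measurable_Rn.
pose pf : {measure set T -> \bar R} := pushforward leb (id : Rn R n -> T).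
transitivity (\int[pf mid]_x f x); first by rewrite ge0_integral_pushforward.
apply: eq_measure_integral => A mA _; exact: leb_borel.
Qed.

Lemma integral_leb (f : T -> \bar R) : measurable_fun setT f ->
  \int[leb]_x f x = \int[mu]_x f x.
Proof.
move=> mf; rewrite integralE [RHS]integralE; congr (_ - _).
  by apply: ge0_integral_leb => //; exact: measurable_funepos.
by apply: ge0_integral_leb => //; exact: measurable_funeneg.
Qed.

Lemma leb_ae_null (P : Rn R n -> Prop) : {ae leb, forall x, P x} ->
  leb [set x | ~ P x] = 0.
Proof.
move=> [N [_ N0 sub]]; apply/eqP; rewrite eq_le; apply/andP; split; last first.
  exact: (outer_measure_ge0 ((borel_lebesgue R n)^*)%mu).
by rewrite -N0; apply: leb_le.
Qed.

(** What remains of membership in S_0 and in L^1 + L^oo.  It makes F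
    integrable against Gaussians, and makes its heat extension tend to 0. *)
Definition small_plus_integrable (F : T -> R) := forall e : R, (0 < e)%R ->
  exists psi : T -> R, [/\ measurable_fun setT psi, (forall x, 0 <= psi x)%R,
    \int[mu]_x (psi x)%:E < +oo & forall x, (`|F x| <= e + psi x)%R].

(** The integrable function is |F| on the set where |F| > e.  That set has
    finite measure since f is in S_0, so the bounded summand of f is integrable
    on it. *)
Lemma L1_plus_Loo_representative (f : Rn R n -> \bar R) : S0 f -> L1_plus_Loo f ->
  exists (F : T -> R) (M : set T), [/\ measurable_fun setT F, measurable M, mu M = 0,
    forall x, ~ M x -> f x = (F x)%:E & small_plus_integrable F].
Proof.
move=> [mf ffin fd] [g [k [gL kL fE]]].
have [K K0 kK] : exists2 K : R, (0 <= K)%R & {ae leb, forall x, (`|k x| <= K)%R}.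
  have /andP[_] := kL; rewrite inE/= /finite_norm unlock.
  case: ifPn => [_ kfin|mu0 _].
    have := ess_sup_ge leb (abse \o (EFin \o k)).
    case: (ess_sup _ _) kfin => [r||]//= _.
      move=> h; exists (Num.max r 0)%R; first by rewrite le_max lexx orbT.
      by apply: filterS h => x /=; rewrite lee_fin => /le_trans; apply; rewrite le_max lexx.
    by move=> h; exists 0%R => //; apply: filterS h => x /=; rewrite leeNy_eq.
  exists 0%R => //; exists setT; split => //.
  by apply/eqP; rewrite eq_le measure_ge0 andbT leNgt.
pose M0 := [set x | ~ (f x \is a fin_num)] `|` [set x | ~ (f x = (g x + k x)%:E)]
  `|` [set x | ~ (`|k x| <= K)%R].
have M00 : leb M0 = 0.
  apply/eqP; rewrite eq_le; apply/andP; split; last first.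
    exact: (outer_measure_ge0 ((borel_lebesgue R n)^*)%mu).
  apply: le_trans (leb_le_setU _ _) _; rewrite (leb_ae_null kK) adde0.
  by apply: le_trans (leb_le_setU _ _) _; rewrite (leb_ae_null ffin) (leb_ae_null fE) adde0.
have mff : measurable_fun setT (fun x : Rn R n => fine (f x)).
  by apply: measurableT_comp => //.
have [M [mM muM M0M mF]] := @caratheodory_measurable_fun_borel _ _ _ mu M0 _ M00 mff.
set F := (fun x => if _ then _ else _) in mF.
have FM x : M x -> F x = 0%R by move=> Mx; rewrite /F mem_set.
have Ff x : ~ M x -> f x = (F x)%:E.
  move=> Mx; rewrite /F memNset// fineK//; apply: contrapT => h; apply: Mx; apply: M0M.
  by left; left.
clearbody F.
exists F, M; split => //.
move=> e e0.
pose E := [set x : T | (e < `|F x|)%R].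
have mE : measurable E.
  have -> : E = setT `&` (fun x => `|F x|)%R @^-1` `]e, +oo[%classic.
    by rewrite setTI; apply/seteqP; split => x /=; rewrite in_itv/= andbT.
  by apply: measurableT_comp => //.
have Efin : mu E < +oo.
  rewrite -leb_borel//; apply: le_lt_trans (fd e e0).
  apply: leb_le => x /= eF; have Mx : ~ M x.
    by move=> /FM Fx; move: eF; rewrite /E /= Fx normr0; apply/negP; rewrite -leNgt ltW.
  by rewrite Ff// abse_EFin lte_fin.
exists (fun x => `|F x| * \1_E x)%R; split.
- by apply: measurable_funM; [exact: measurableT_comp|exact: measurable_indic].
- by move=> x; rewrite mulr_ge0.
- rewrite -ge0_integral_leb; last 2 first.
  + apply/measurable_EFinP; apply: measurable_funM; [exact: measurableT_comp|exact: measurable_indic].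
  + by move=> x; rewrite lee_fin mulr_ge0.
  have gi : leb.-integrable setT (EFin \o g) by apply/Lfun1_integrable.
  apply: (@le_lt_trans _ _ (\int[leb]_x (`|(EFin \o g) x| + K%:E * (\1_E x)%:E))).
    apply: ge0_le_integral_nomeas => x _; first by rewrite lee_fin mulr_ge0.
    rewrite /= -EFinM -EFinD lee_fin indicE.
    have [Mx|Mx] := pselect (M x).
      by rewrite FM// normr0 mul0r addr_ge0// mulr_ge0.
    case: (x \in E); rewrite ?mulr0 ?mulr1 ?addr0//.
    have nM0 : ~ M0 x by move=> /M0M.
    have fx : f x = (g x + k x)%:E by apply: contrapT => h; apply: nM0; left; right.
    have kx : (`|k x| <= K)%R by apply: contrapT => h; apply: nM0; right.
    move: fx; rewrite (Ff x Mx) => -[->].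
    by apply: le_trans (ler_normD _ _) _; rewrite lerD2l.
  apply: integral_norm_add_indic => //.
    exact: borel_measurable_Rn mE.
  by move: Efin; rewrite -(leb_borel mE).
- move=> x; rewrite indicE; case: (boolP (x \in E)) => [_|].
    by rewrite mulr1 lerDr ltW.
  by rewrite notin_setE /E /= mulr0 addr0 => /negP; rewrite -leNgt.
Qed.

(** For fixed [x], the set of [y] with x - y in a null set is null, as
    Lebesgue measure is invariant under reflections; so [heat f] does not see
    the change of representative at any point. *)
Lemma heat_representative (f : Rn R n -> \bar R) (F : T -> R) (M : set T) (h : R) (x : T) :
  measurable_fun setT F -> measurable M -> mu M = 0 ->
  (forall x, ~ M x -> f x = (F x)%:E) ->
  heat f h (x : Rn R n) = (\int[mu]_y (heat_kernel h (y : Rn R n) * F (subT x y)))%R.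
Proof.
move=> mF mM muM fF.
rewrite /heat /Rintegral; congr fine.
have mG : measurable_fun setT (fun y : T => (heat_kernel h (y : Rn R n) * F (subT x y))%:E).
  apply/measurable_EFinP; apply: measurable_funM; first exact: measurable_heat_kernel.
  by apply: measurableT_comp => //; exact: measurable_subTr.
rewrite -integral_leb//.
have AE : ae_eq leb setT (fun y : Rn R n => (heat_kernel h y * F (subT x y))%:E)
   (fun y => (heat_kernel h y)%:E * f (sub_Rn x y)).
  have mS : measurable (setT `&` subT x @^-1` M).
    exact: measurable_subTr.
  rewrite setTI in mS.
  exists (subT x @^-1` M); split.
  - exact: borel_measurable_Rn.
  - have : \int[mu]_y (\1_M (subT x y))%:E = 0.
      rewrite (ge0_integral_reflect x (phi := fun y => (\1_M y)%:E)).
      + by rewrite integral_indic// setIT.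
      + by apply/measurable_EFinP; exact: measurable_indic.
      + by move=> y; rewrite lee_fin.
    under eq_integral do rewrite -[\1_M _]/(\1_(subT x @^-1` M) _).
    by rewrite integral_indic// setIT leb_borel.
  - move=> y /= h'; apply: contrapT => Mx; apply: h' => _.
    by rewrite EFinM -fF.
have mG' := borel_measurable_fun mG.
have mH := ae_measurable_fun leb_complete AE mG'.
apply: ae_eq_integral; [exact: measurableT|exact: mH|exact: mG'|exact: ae_eq_sym].
Qed.

End representative.

(** * The heat extension as a function of the height *)

(** Powers of the squared norm are absorbed by a Gaussian, at the cost of a
    constant. *)
Lemma expR_ge_pow (R : realType) (x : R) (j : nat) : 0 <= x ->
  x ^+ j <= j.+1%:R ^+ j * expR x.
Proof.
move=> x0; have j0 : 0 < j.+1%:R :> R by rewrite ltr0n.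
have h : x / j.+1%:R <= expR (x / j.+1%:R).
  by apply: le_trans (expR_ge1Dx _); rewrite lerDr.
have : (x / j.+1%:R) ^+ j <= expR x.
  apply: (@le_trans _ _ (expR (x / j.+1%:R) ^+ j)).
    by rewrite lerXn2r// nnegrE ?expR_ge0// divr_ge0// ltW.
  rewrite -expRM_natl ler_expR mulrCA ler_piMr//.
  by rewrite ler_pdivrMr// mul1r ler_nat.
by rewrite expr_div_n ler_pdivrMr ?exprn_gt0// mulrC.
Qed.

Section laplace.
Context (R : realType) (n : nat).
Notation T := (n.-tuple (measurableTypeR R)).
Notation mu := (borel_lebesgue R n).
Local Open Scope ereal_scope.

Definition sqnorm (y : T) : R := (\sum_(i < n) tnth y i ^+ 2)%R.

Lemma sqnorm_ge0 y : (0 <= sqnorm y)%R.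
Proof. by apply: sumr_ge0 => i _; exact: sqr_ge0. Qed.

Lemma measurable_sqnorm : measurable_fun setT sqnorm.
Proof.
by apply: measurable_sum => i; apply: measurable_funX; exact: measurable_tnth.
Qed.

Lemma heat_kernel_sqnorm (h : R) (y : T) : heat_kernel h (y : Rn R n) =
  ((4 * pi * h) `^ (- (n%:R / 2)) * expR (- ((4 * h)^-1 * sqnorm y)))%R.
Proof. by rewrite /heat_kernel mulNr mulrC (mulrC (sqnorm y)) mulrC. Qed.

Lemma measurable_expR_sqnorm (t : R) : measurable_fun setT (fun y => expR (- (t * sqnorm y))).
Proof.
apply: measurableT_comp; first exact: measurable_expR.
apply: measurableT_comp => //; apply: measurable_funM => //.
exact: measurable_sqnorm.
Qed.

Lemma integral_gauss_lty (t : R) : (0 < t)%R ->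
  \int[mu]_y (expR (- (t * sqnorm y)))%:E < +oo.
Proof.
move=> t0; pose h := ((4 * t)^-1)%R.
have h0 : (0 < h)%R by rewrite invr_gt0 mulr_gt0.
have := @integral_heat_kernel R n h h0.
under eq_integral do rewrite heat_kernel_sqnorm EFinM.
have c0 : (0 < (4 * pi * h) `^ (- (n%:R / 2)))%R.
  by rewrite powR_gt0// !mulr_gt0// pi_gt0.
rewrite ge0_integralZl//; last 2 first.
  by apply/measurable_EFinP; exact: measurable_expR_sqnorm.
  by rewrite lee_fin ltW.
have -> : ((4 * h)^-1 = t)%R by rewrite /h; field; rewrite gt_eqF.
case: (\int[mu]_y _) => [r||]//; first by rewrite ltry.
by rewrite gt0_muley ?lte_fin.
Qed.

Variables (F : T -> R).
Hypothesis mF : measurable_fun setT F.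
Hypothesis FP : small_plus_integrable F.
Variable x : T.

Lemma measurable_Fsub : measurable_fun setT (fun y => F (subT x y)).
Proof. by apply: measurableT_comp => //; exact: measurable_subTr. Qed.

Lemma integral_gauss_F_lty (t : R) : (0 < t)%R ->
  \int[mu]_y (expR (- (t * sqnorm y)) * `|F (subT x y)|)%:E < +oo.
Proof.
move=> t0; have [psi [mpsi psi0 psify Fpsi]] := FP (@ltr01 R).
apply: (@le_lt_trans _ _ (\int[mu]_y ((expR (- (t * sqnorm y)))%:E + (psi (subT x y))%:E))).
  apply: ge0_le_integral_nomeas => y _; first by rewrite lee_fin mulr_ge0// expR_ge0.
  rewrite -EFinD lee_fin; set e := expR _.
  have e0 : (0 <= e)%R by rewrite expR_ge0.
  have e1 : (e <= 1)%R.
    by rewrite /e -[leRHS]expR0 ler_expR oppr_le0 mulr_ge0 ?sqnorm_ge0// ltW.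
  have := ler_wpM2l e0 (Fpsi (subT x y)); have := psi0 (subT x y); nra.
rewrite ge0_integralD//.
- rewrite (ge0_integral_reflect x (phi := fun y => (psi y)%:E)).
  + by rewrite lte_add_pinfty// integral_gauss_lty.
  + exact/measurable_EFinP.
  + by move=> y; rewrite lee_fin.
- by apply/measurable_EFinP; exact: measurable_expR_sqnorm.
- by move=> y _; rewrite lee_fin.
- by apply/measurable_EFinP; apply: measurableT_comp => //; exact: measurable_subTr.
Qed.

(** As functions of [t], these are the successive derivatives, up to sign, of
    the integrand e^(-t |y|^2) F(x - y). *)
Definition moment (j : nat) (t : R) (y : T) : R :=
  (sqnorm y ^+ j * expR (- (t * sqnorm y)) * F (subT x y))%R.

Lemma measurable_moment j t : measurable_fun setT (moment j t).
Proof.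
apply: measurable_funM; last exact: measurable_Fsub.
apply: measurable_funM; last exact: measurable_expR_sqnorm.
by apply: measurable_funX; exact: measurable_sqnorm.
Qed.

Lemma integrable_moment j t : (0 < t)%R -> mu.-integrable setT (EFin \o moment j t).
Proof.
move=> t0; apply/integrableP; split.
  by apply/measurable_EFinP; exact: measurable_moment.
pose t2 := (t / 2)%R.
have t20 : (0 < t2)%R by rewrite divr_gt0.
pose C := (j.+1%:R ^+ j / t2 ^+ j)%R.
have C0 : (0 <= C)%R by rewrite divr_ge0 ?exprn_ge0// ltW.
apply: (@le_lt_trans _ _ (\int[mu]_y (C%:E * (expR (- (t2 * sqnorm y)) * `|F (subT x y)|)%:E))).
  apply: ge0_le_integral_nomeas => y _; first exact: abse_ge0.
  rewrite /= -EFinM lee_fin !normrM (ger0_norm (expR_ge0 _)) mulrA.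
  apply: ler_wpM2r => //.
  rewrite ger0_norm ?exprn_ge0 ?sqnorm_ge0//.
  have -> : (- (t * sqnorm y) = - (t2 * sqnorm y) - (t2 * sqnorm y))%R.
    by rewrite /t2; field.
  rewrite expRD mulrA; apply: ler_wpM2r; first exact: expR_ge0.
  rewrite expRN ler_pdivrMr ?expR_gt0//.
  have := expR_ge_pow j (mulr_ge0 (ltW t20) (sqnorm_ge0 y)).
  rewrite exprMn mulrC -ler_pdivlMr ?exprn_gt0// => /le_trans; apply.
  by rewrite /C mulrAC.
rewrite ge0_integralZl//.
- by rewrite lte_mul_pinfty ?lee_fin// integral_gauss_F_lty.
- apply/measurable_EFinP; apply: measurable_funM; first exact: measurable_expR_sqnorm.
  by apply: measurableT_comp => //; exact: measurable_Fsub.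
Qed.

Definition laplace (j : nat) (t : R) : R := (\int[mu]_y moment j t y)%R.

Local Close Scope ereal_scope.

Lemma is_derive_moment j (t : R) y :
  is_derive t 1 (fun t : R => moment j t y) (- moment j.+1 t y)%R.
Proof.
have -> : (fun t : R => moment j t y) =
    (sqnorm y ^+ j * F (subT x y)) *: (expR \o (fun t : R => - sqnorm y * t)) :> (R -> R).
  apply/funext => u; rewrite /moment /= mulrAC.
  by rewrite -[RHS]/(sqnorm y ^+ j * F (subT x y) * expR (- sqnorm y * u)) mulNr (mulrC u).
have d1 : is_derive t 1 (fun t : R => - sqnorm y * t) (- sqnorm y * 1).
  exact: (is_deriveZ (- sqnorm y) (is_derive_id t (1 : R))).
have d2 := @is_derive1_comp R expR (fun t : R => - sqnorm y * t) t _ _ (is_derive_expR _) d1.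
have d3 := is_deriveZ (sqnorm y ^+ j * F (subT x y)) d2.
apply: is_derive_eq.
rewrite -[LHS]/(sqnorm y ^+ j * F (subT x y) * (expR (- sqnorm y * t) * (- sqnorm y * 1))).
rewrite /moment exprS (_ : - sqnorm y * t = - (t * sqnorm y)); ring.
Qed.

(** Near [t], the derivatives of the integrand are dominated by its next
    moment at t / 2. *)
Lemma is_derive_laplace j (t : R) : (0 < t)%R ->
  is_derive t 1 (laplace j) (- laplace j.+1 t)%R.
Proof.
move=> t0; pose t2 := (t / 2)%R.
have t20 : (0 < t2)%R by rewrite divr_gt0.
have It : (`]t2, (t + 1)%R[%classic : set R) t.
  by rewrite /= in_itv/=; apply/andP; split; rewrite /t2; lra.
have H u : (`]t2, (t + 1)%R[%classic : set R) u -> (0 < u)%R.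
  by rewrite /= in_itv/= => /andP[+ _]; apply: lt_trans.
have d1E u y : partial1of2 (moment j) u y = (- moment j.+1 u y)%R.
  by rewrite partial1of2E; have [_ ->] := is_derive_moment j u y.
pose G y := `|moment j.+1 t2 y|%R.
have G0 y : (0 <= G y)%R by rewrite /G normr_ge0.
have iG : mu.-integrable setT (EFin \o G).
  exact: (integrable_norm (integrable_moment j.+1 t20)).
have inti u : (`]t2, (t + 1)%R[%classic : set R) u -> mu.-integrable setT (EFin \o moment j u).
  by move=> /H; exact: integrable_moment.
have der u y : (`]t2, (t + 1)%R[%classic : set R) u -> setT y -> derivable (fun t : R => moment j t y) u 1.
  by move=> _ _; have [] := is_derive_moment j u y.
have Gub u y : (`]t2, (t + 1)%R[%classic : set R) u -> setT y -> (`|partial1of2 (moment j) u y| <= G y)%R.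
  move=> /= + _; rewrite in_itv/= => /andP[t2u _]; rewrite d1E normrN /G /moment !normrM.
  apply: ler_wpM2r => //; apply: ler_wpM2l => //.
  rewrite !ger0_norm ?expR_ge0// ler_expR lerN2 ler_wpM2r ?sqnorm_ge0//.
  exact: ltW.
split.
- exact: (derivable_under_integral measurableT It inti der G0 iG Gub).
- rewrite -derive1E (differentiation_under_integral measurableT It inti der G0 iG Gub).
  rewrite /laplace -mulN1r -RintegralZl//; last exact: integrable_moment.
  by apply: eq_Rintegral => y _; rewrite mulN1r; exact: d1E.
Qed.

(** Finite combinations of h^a L_j(1/(4h)), where L_j is [laplace j]; the
    triples list the coefficient, the exponent and the index j. *)
Definition hcomb (s : seq (R * R * nat)) (h : R) : R :=
  (\sum_(c <- s) c.1.1 * h `^ c.1.2 * laplace c.2 ((4 * h)^-1))%R.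

Definition hcomb_derive (s : seq (R * R * nat)) : seq (R * R * nat) :=
  flatten [seq [:: (c.1.1 * c.1.2, c.1.2 - 1, c.2)%R; (c.1.1 / 4, c.1.2 - 2, c.2.+1)%R] | c <- s].

Lemma is_derive_hcomb s (h : R) : (0 < h)%R -> is_derive h 1 (hcomb s) (hcomb (hcomb_derive s) h).
Proof.
move=> h0; elim: s => [|[[c a] j] s IH].
  have -> : hcomb [::] = cst 0%R by apply/funext => u; rewrite /hcomb big_nil.
  exact: is_derive_cst.
have -> : hcomb ((c, a, j) :: s) =
    (fun u : R => c * u `^ a * laplace j ((4 * u)^-1))%R + hcomb s.
  by apply/funext => u; rewrite /hcomb big_cons.
have -> : hcomb (hcomb_derive ((c, a, j) :: s)) h =
    ((c * a * h `^ (a - 1) * laplace j ((4 * h)^-1) +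
     c / 4 * h `^ (a - 2) * laplace j.+1 ((4 * h)^-1)) + hcomb (hcomb_derive s) h)%R.
  by rewrite /hcomb /hcomb_derive /= !big_cons addrA.
apply: is_deriveD.
have i0 : (0 < (4 * h)^-1)%R by rewrite invr_gt0 mulr_gt0.
have dp := is_derive1_powR a h0.
have d4 : is_derive h 1 (fun u : R => 4 * u) (4 * 1).
  exact: (is_deriveZ 4 (is_derive_id h (1 : R))).
have h40 : 4 * h != 0 by rewrite gt_eqF// mulr_gt0.
have di := @is_deriveV R (fun u => 4 * u) h _ 1 h40 d4.
have dL := @is_derive1_comp R (laplace j) (fun u : R => (4 * u)^-1) h _ _ (is_derive_laplace j i0) di.
have dM := is_deriveM dp dL.
have dZ := is_deriveZ c dM.
have -> : (fun u : R => c * u `^ a * laplace j ((4 * u)^-1)) =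
   c *: ((fun u : R => u `^ a) * (laplace j \o (fun u : R => (4 * u)^-1))) :> (R -> R).
  by apply/funext => u; rewrite -mulrA.
apply: is_derive_eq.
rewrite -[LHS]/(c * (h `^ a * (- laplace j.+1 ((4 * h)^-1) * (- (4 * h) ^- 2 * (4 * 1))) +
  laplace j ((4 * h)^-1) * (a * h `^ (a - 1)))).
have -> : h `^ (a - 2) = h `^ a / h ^+ 2.
  by rewrite powRB ?powR_mulrn ?ltW//; apply/implyP => _; rewrite gt_eqF.
field; by rewrite gt_eqF.
Qed.

Lemma heat_integral_hcomb (h : R) : 0 < h ->
  (\int[mu]_y (heat_kernel h (y : Rn R n) * F (subT x y)))%R =
  hcomb [:: ((4 * pi) `^ (- (n%:R / 2)), - (n%:R / 2), 0%N)] h.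
Proof.
move=> h0; rewrite /hcomb big_seq1 /= /laplace -RintegralZl//; last first.
  by apply: integrable_moment; rewrite invr_gt0 mulr_gt0.
apply: eq_Rintegral => y _; rewrite heat_kernel_sqnorm /moment expr0 mul1r mulrA.
by rewrite powRM ?mulr_ge0 ?pi_ge0// ltW.
Qed.

(** The part of F below e / 2 contributes at most e / 2, and the integrable
    rest is multiplied by the maximum of the heat kernel, a negative power of
    the height; this is where n > 0 enters. *)
Lemma heat_decay (e : R) : (0 < n)%N -> 0 < e -> exists X : R, forall h, X <= h ->
  `|(\int[mu]_y (heat_kernel h (y : Rn R n) * F (subT x y)))%R| < e.
Proof.
move=> n0 e0; have e20 : 0 < e / 2 by rewrite divr_gt0.
have [psi [mpsi psi0 psify Fpsi]] := FP e20.
pose P := fine (\int[mu]_y (psi y)%:E)%E.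
have P0 : 0 <= P by rewrite fine_ge0// integral_ge0// => y _; rewrite lee_fin.
have PE : (\int[mu]_y (psi y)%:E = P%:E)%E.
  by rewrite fineK// ge0_fin_numE// integral_ge0// => y _; rewrite lee_fin.
pose d := e / 2 / (P + 1).
have d0 : 0 < d by rewrite divr_gt0// ltr_wpDl.
have nR0 : 0 < n%:R / 2 :> R by rewrite divr_gt0// ltr0n.
exists (1 + d `^ (- (n%:R / 2)^-1) / (4 * pi)) => h hX.
have pi40 : 0 < 4 * pi :> R by rewrite mulr_gt0// pi_gt0.
have h1 : 1 <= h by apply: le_trans hX; rewrite lerDl divr_ge0 ?powR_ge0// ltW.
have h0 : 0 < h by apply: lt_le_trans h1.
have ckd : (4 * pi * h) `^ (- (n%:R / 2)) <= d.
  have -> : d = (d `^ (- (n%:R / 2)^-1)) `^ (- (n%:R / 2)).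
    by rewrite -powRrM mulrNN mulVf ?gt_eqF// powRr1// ltW.
  have D0 : 0 < d `^ (- (n%:R / 2)^-1) by rewrite powR_gt0.
  have H0 : 0 < 4 * pi * h by rewrite mulr_gt0.
  rewrite !(powRN _ (n%:R / 2)) lef_pV2; last 2 first.
  - by rewrite posrE powR_gt0.
  - by rewrite posrE powR_gt0.
  apply: ge0_ler_powR.
  - exact: ltW.
  - by rewrite nnegrE powR_ge0.
  - by rewrite nnegrE mulr_ge0// ltW.
  rewrite (mulrC _ h) -ler_pdivrMr//; apply: le_trans hX; by rewrite lerDr.
have mk := @measurable_heat_kernel R n h.
have k0 y : 0 <= heat_kernel h (y : Rn R n) by rewrite ltW// heat_kernel_gt0.
have mpsix : measurable_fun setT (fun y => psi (subT x y)).
  by apply: measurableT_comp => //; exact: measurable_subTr.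
have le : (\int[mu]_y `|(heat_kernel h (y : Rn R n) * F (subT x y))%:E| <=
    (e / 2 + d * P)%:E)%E.
  apply: (@le_trans _ _ (\int[mu]_y ((e / 2)%:E * (heat_kernel h (y : Rn R n))%:E +
      d%:E * (psi (subT x y))%:E))%E).
    apply: ge0_le_integral_nomeas => y _; first exact: abse_ge0.
    rewrite -!EFinM -EFinD lee_fin normrM (ger0_norm (k0 y)).
    apply: le_trans (ler_wpM2l (k0 y) (Fpsi _)) _.
    rewrite mulrDr (mulrC (heat_kernel _ _)) lerD2l ler_wpM2r//.
    rewrite heat_kernel_sqnorm; apply: le_trans ckd.
    rewrite ler_piMr ?powR_ge0// -[leRHS]expR0 ler_expR oppr_le0 mulr_ge0 ?sqnorm_ge0//.
    by rewrite invr_ge0 mulr_ge0// ltW.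
  have Ipsi : (\int[mu]_y (psi (subT x y))%:E = P%:E)%E.
    rewrite (ge0_integral_reflect x (phi := fun y => (psi y)%:E)) ?PE//.
    exact/measurable_EFinP.
  have m1 : measurable_fun setT (fun y : T => (heat_kernel h (y : Rn R n))%:E) by exact/measurable_EFinP.
  have m2 : measurable_fun setT (fun y : T => (psi (subT x y))%:E) by exact/measurable_EFinP.
  have m1' : measurable_fun setT (fun y : T => (e / 2)%:E * (heat_kernel h (y : Rn R n))%:E)%E.
    exact: emeasurable_funM.
  have m2' : measurable_fun setT (fun y : T => d%:E * (psi (subT x y))%:E)%E.
    exact: emeasurable_funM.
  have g1 (y : T) : setT y -> (0 <= (heat_kernel h (y : Rn R n))%:E)%E by rewrite lee_fin.
  have g2 (y : T) : setT y -> (0 <= (psi (subT x y))%:E)%E by rewrite lee_fin.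
  have g1' (y : T) : setT y -> (0 <= (e / 2)%:E * (heat_kernel h (y : Rn R n))%:E)%E.
    by move=> yT; rewrite mule_ge0 ?g1// lee_fin ltW.
  have g2' (y : T) : setT y -> (0 <= d%:E * (psi (subT x y))%:E)%E.
    by move=> yT; rewrite mule_ge0 ?g2// lee_fin ltW.
  rewrite ge0_integralD// !ge0_integralZl//; last 2 first.
  - by rewrite lee_fin ltW.
  - by rewrite lee_fin ltW.
  by rewrite integral_heat_kernel// Ipsi mule1 -EFinM -EFinD.
have mkF : measurable_fun setT (fun y : T => (heat_kernel h (y : Rn R n) * F (subT x y))%:E).
  by apply/measurable_EFinP; exact: (measurable_funM mk measurable_Fsub).
have imkF : mu.-integrable setT (fun y : T => (heat_kernel h (y : Rn R n) * F (subT x y))%:E).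
  by apply/integrableP; split; [exact: mkF|apply: (le_lt_trans le); exact: ltry].
have : (`|(\int[mu]_y (heat_kernel h (y : Rn R n) * F (subT x y)))%R| <= e / 2 + d * P).
  rewrite -lee_fin EFin_normr_Rintegral//.
  apply: le_trans le; exact: le_abse_integral mkF.
move=> /le_lt_trans; apply.
rewrite -ltrBrDl (_ : e - e / 2 = e / 2); last by field.
rewrite /d -mulrA mulrC -ltr_pdivlMr// divff ?gt_eqF//.
by rewrite mulrC ltr_pdivrMr ?mul1r ?ltrDl// ltr_wpDl.
Qed.

End laplace.

Lemma derive1n_chain (R : realType) (u : R -> R) (v : nat -> R -> R) :
  (forall h, 0 < h -> u h = v 0 h) ->
  (forall k (h : R), 0 < h -> is_derive h 1 (v k) (v k.+1 h)) ->
  forall k h, 0 < h -> derive1n k u h = v k h.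
Proof.
move=> u0 dv; elim=> [|k IH] h h0; first by rewrite derive1n0 u0.
rewrite derive1nS derive1E; have [_ <-] := dv k h h0.
apply: near_eq_derive; apply: filterS (lt_nbhsr h0) => t t0.
exact: IH.
Qed.

(** * Convergence in the mean of the heat extension at height zero *)

Section recovery.
Context (R : realType) (n : nat).
Notation T := (n.-tuple (measurableTypeR R)).
Notation mu := (borel_lebesgue R n).
Notation K h y := (heat_kernel h (y : Rn R n)).

Definition gauss (t : R) (y : T) : R := expR (- (t * sqnorm y)).

Lemma gauss_gt0 t y : 0 < gauss t y. Proof. exact: expR_gt0. Qed.

Lemma gauss_ge0 t y : 0 <= gauss t y. Proof. exact: expR_ge0. Qed.

Lemma sqnorm_triangle (x y : T) : sqnorm (subT x y) <= 2 * sqnorm x + 2 * sqnorm y.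
Proof.
rewrite /sqnorm !mulr_sumr -big_split; apply: ler_sum => i _ /=.
rewrite tnth_mktuple; set a := tnth x i; set b := tnth y i.
have := sqr_ge0 (a + b); nra.
Qed.

Lemma sqr_tnth_le_sqnorm (y : T) i : tnth y i ^+ 2 <= sqnorm y.
Proof.
by rewrite /sqnorm (bigD1 i)//= lerDl sumr_ge0// => j _; exact: sqr_ge0.
Qed.

Lemma heat_kernel_double (h : R) (y : T) : 0 < h ->
  K h y = 2 `^ (n%:R / 2) * expR (- ((8 * h)^-1 * sqnorm y)) * K (2 * h) y.
Proof.
move=> h0; rewrite !heat_kernel_sqnorm.
have p4 : 0 <= 4 * pi * h by rewrite !mulr_ge0 ?pi_ge0// ltW.
rewrite (_ : 4 * pi * (2 * h) = 2 * (4 * pi * h)); last by ring.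
rewrite (@powRM _ 2 (4 * pi * h))// (_ : - ((4 * h)^-1 * sqnorm y) = - ((8 * h)^-1 * sqnorm y) - ((4 * (2 * h))^-1 * sqnorm y)); last first.
  by field; rewrite gt_eqF.
rewrite expRD (powRN 2).
have : 2 `^ (n%:R / 2) != 0 :> R by rewrite gt_eqF// powR_gt0.
by move=> ?; field.
Qed.

(** Half of the exponent of the heat kernel, which is at least |y|^2 when
    h <= 1/8, pays for moving the Gaussian weight from x to x - y, because
    |x - y|^2 <= 2 |x|^2 + 2 |y|^2. *)
Lemma heat_kernel_shift_weight (h : R) (x y : T) : 0 < h -> h <= 8^-1 ->
  K h y * gauss 1 x <= 2 `^ (n%:R / 2) * K (2 * h) y * gauss 2^-1 (subT x y).
Proof.
move=> h0 h8; rewrite heat_kernel_double//.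
have k0 : 0 <= K (2 * h) y by rewrite ltW// heat_kernel_gt0// mulr_gt0.
set c := 2 `^ _; have c0 : 0 <= c by rewrite powR_ge0.
set e := expR _; rewrite (_ : c * e * K (2 * h) y * gauss 1 x =
  c * K (2 * h) y * (e * gauss 1 x)); last by ring.
apply: ler_wpM2l; first exact: mulr_ge0.
rewrite /e /gauss -expRD ler_expR.
(* so half of the exponent of the heat kernel dominates |y|^2 *)
have h8' : 1 <= (8 * h)^-1.
  by rewrite invf_ge1 ?mulr_gt0// mulrC -ler_pdivlMr// mul1r.
have := sqnorm_triangle x y; have := sqnorm_ge0 y; have := sqnorm_ge0 x.
move: (sqnorm x) (sqnorm y) (sqnorm _) => a b d a0 b0 dab.
have : b <= (8 * h)^-1 * b by rewrite ler_peMl.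
lra.
Qed.

(** One has a <= 16 s (1 + a^2 / (8 s^2)) for s > 0 and a >= 0; apply it
    with s^2 = h and absorb the right-hand side in half of the exponent of the
    heat kernel. *)
Lemma heat_kernel_first_moment (h : R) (y : T) i : 0 < h -> h <= 1 ->
  K h y * `|tnth y i| <= 16 * Num.sqrt h * 2 `^ (n%:R / 2) * K (2 * h) y.
Proof.
move=> h0 h1; rewrite heat_kernel_double//.
have k0 : 0 <= K (2 * h) y by rewrite ltW// heat_kernel_gt0// mulr_gt0.
set c := 2 `^ _; have c0 : 0 <= c by rewrite powR_ge0.
set e := expR _; rewrite (_ : c * e * K (2 * h) y * `|tnth y i| =
  c * K (2 * h) y * (e * `|tnth y i|)); last by ring.
rewrite (_ : 16 * _ * c * K (2 * h) y = c * K (2 * h) y * (16 * Num.sqrt h)); last by ring.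
apply: ler_wpM2l; first exact: mulr_ge0.
rewrite /e expRN mulrC ler_pdivrMr ?expR_gt0//.
set s := Num.sqrt h; have s0 : 0 < s by rewrite sqrtr_gt0.
have hE : h = s ^+ 2 by rewrite [RHS]sqr_sqrtr//; exact: ltW.
set a := `|tnth y i|; have a0 : 0 <= a by rewrite /a normr_ge0.
have : 1 + (8 * h)^-1 * a ^+ 2 <= expR ((8 * h)^-1 * sqnorm y).
  apply: le_trans (expR_ge1Dx _); rewrite lerD2l ler_wpM2l ?invr_ge0 ?mulr_ge0 ?(ltW h0)//.
  by rewrite /a real_normK ?num_real// sqr_tnth_le_sqnorm.
move=> /(ler_wpM2l (ltW s0)) => H.
have : a <= 16 * (s * (1 + (8 * h)^-1 * a ^+ 2)).
  rewrite hE (_ : 16 * _ = (16 * s ^+ 2 + 2 * a ^+ 2) / s); last by field; rewrite gt_eqF.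
  rewrite ler_pdivlMr//; have := sqr_ge0 (s - a); nra.
move=> /le_trans; apply; rewrite -[leRHS]mulrA ler_wpM2l//.
Qed.

Lemma measurable_gauss t : measurable_fun setT (gauss t).
Proof. exact: measurable_expR_sqnorm. Qed.

Local Open Scope ereal_scope.

(** The mean of |F(x - y) - F(x)| for the heat kernel in y and a Gaussian
    weight in x.  The weight makes bounded functions as manageable as
    integrable ones. *)
Definition oscillation (h : R) (F : T -> R) : \bar R :=
  \int[(mu \x mu)%E]_z (gauss 1 z.1 * K h z.2 * `|F (subT z.1 z.2) - F z.1|)%:E.

Definition wnorm (F : T -> R) : \bar R := \int[mu]_x (gauss 2^-1 x * `|F x|)%:E.

(** The oscillation tends to 0 with the height. *)
Definition recoverable (F : T -> R) := forall e : R, (0 < e)%R ->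
  exists2 d : R, (0 < d)%R & forall h, (0 < h)%R -> (h < d)%R -> oscillation h F <= e%:E.

Lemma measurable_weight h : measurable_fun setT (fun z : T * T => gauss 1 z.1 * K h z.2)%R.
Proof.
apply: measurable_funM.
  by apply: (measurableT_comp (measurable_gauss 1)).
by apply: (measurableT_comp (@measurable_heat_kernel R n h)).
Qed.

Lemma measurable_osc_integrand h (F : T -> R) : measurable_fun setT F ->
  measurable_fun setT (fun z : T * T =>
    (gauss 1 z.1 * K h z.2 * `|F (subT z.1 z.2) - F z.1|)%:E).
Proof.
move=> mF; apply/measurable_EFinP; apply: measurable_funM; first exact: measurable_weight.
apply: measurableT_comp => //; apply: measurable_funB.
  apply: (measurableT_comp mF); exact: measurable_subT.
exact: (measurableT_comp mF).
Qed.

Lemma weight_ge0 h (z : T * T) : (0 < h)%R -> (0 <= gauss 1 z.1 * K h z.2)%R.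
Proof. by move=> h0; rewrite mulr_ge0 ?gauss_ge0// ltW// heat_kernel_gt0. Qed.

Lemma osc_integrand_ge0 h (F : T -> R) (z : T * T) : (0 < h)%R ->
  0 <= (gauss 1 z.1 * K h z.2 * `|F (subT z.1 z.2) - F z.1|)%:E.
Proof. by move=> h0; rewrite lee_fin mulr_ge0// weight_ge0. Qed.

Lemma oscillation_triangle h (F G1 G2 : T -> R) : (0 < h)%R ->
  measurable_fun setT G1 -> measurable_fun setT G2 ->
  (forall x y, `|F x - F y| <= `|G1 x - G1 y| + `|G2 x - G2 y|)%R ->
  oscillation h F <= oscillation h G1 + oscillation h G2.
Proof.
move=> h0 m1 m2 FG; rewrite /oscillation -ge0_integralD//.
- apply: ge0_le_integral_nomeas => z _; first exact: osc_integrand_ge0.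
  by rewrite -EFinD lee_fin -mulrDr ler_wpM2l// weight_ge0.
- by move=> z _; exact: osc_integrand_ge0.
- exact: measurable_osc_integrand.
- by move=> z _; exact: osc_integrand_ge0.
- exact: measurable_osc_integrand.
Qed.

(** The weight of [wnorm] is wider than that of [oscillation], which leaves
    room for the translations. *)
Lemma oscillation_le_wnorm h (F : T -> R) : (0 < h)%R -> (h <= 8^-1)%R ->
  measurable_fun setT F ->
  oscillation h F <= (2 `^ (n%:R / 2) + 1)%:E * wnorm F.
Proof.
move=> h0 h8 mF.
have mS : measurable_fun setT (fun z : T * T => F (subT z.1 z.2)).
  by apply: (measurableT_comp mF); exact: measurable_subT.
have mN : measurable_fun setT (fun x : T => (gauss 2^-1 x * `|F x|)%:E).
  apply/measurable_EFinP; apply: measurable_funM; first exact: measurable_gauss.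
  exact: measurableT_comp.
have N0 x : 0 <= (gauss 2^-1 x * `|F x|)%:E by rewrite lee_fin mulr_ge0// gauss_ge0.
have wN0 : 0 <= wnorm F by apply: integral_ge0.
have Kint : \int[mu]_y (K h y)%:E = 1 by exact: integral_heat_kernel.
have K0 y : (0 <= K h y)%R by rewrite ltW// heat_kernel_gt0.
have h20 : (0 < 2 * h)%R by rewrite mulr_gt0.
have K20 y : (0 <= K (2 * h) y)%R by rewrite ltW// heat_kernel_gt0.
pose f1 (z : T * T) := (gauss 1 z.1 * K h z.2 * `|F (subT z.1 z.2)|)%:E.
pose f2 (z : T * T) := (gauss 1 z.1 * K h z.2 * `|F z.1|)%:E.
have mf1 : measurable_fun setT f1.
  apply/measurable_EFinP; apply: measurable_funM; first exact: measurable_weight.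
  exact: (measurableT_comp _ mS).
have mf2 : measurable_fun setT f2.
  apply/measurable_EFinP; apply: measurable_funM; first exact: measurable_weight.
  by apply: measurableT_comp => //; exact: (measurableT_comp mF).
have f10 z : 0 <= f1 z by rewrite lee_fin mulr_ge0// weight_ge0.
have f20 z : 0 <= f2 z by rewrite lee_fin mulr_ge0// weight_ge0.
have I1 : \int[(mu \x mu)%E]_z f1 z <= (2 `^ (n%:R / 2))%:E * wnorm F.
  rewrite (fubini_tonelli1 f1 mf1 f10) (fubini_tonelli f1 mf1 f10).
  apply: (@le_trans _ _ (\int[mu]_y ((K (2 * h) y)%:E * ((2 `^ (n%:R / 2))%:E * wnorm F)))).
    apply: ge0_le_integral_nomeas => y _; first by apply: integral_ge0.
    have mNy : measurable_fun setT (fun x : T => (gauss 2^-1 (subT x y) * `|F (subT x y)|)%:E).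
      apply: (measurableT_comp mN); exact: measurable_subTl.
    rewrite /wnorm -(ge0_integral_translate y mN N0) muleA -EFinM -ge0_integralZl//.
    - apply: ge0_le_integral_nomeas => x _; first exact: f10.
      rewrite /f1 /= -EFinM lee_fin [leRHS]mulrA.
      apply: ler_wpM2r => //; rewrite (mulrC (gauss 1 _)) (mulrC (K _ _)  (2 `^ _)%R).
      exact: heat_kernel_shift_weight.
    - by rewrite lee_fin mulr_ge0 ?powR_ge0.
  rewrite ge0_integralZr//.
  - by rewrite integral_heat_kernel// mul1e.
  - by apply/measurable_EFinP; exact: measurable_heat_kernel.
  - by move=> y _; rewrite lee_fin.
  - by rewrite mule_ge0// lee_fin powR_ge0.
have I2 : \int[(mu \x mu)%E]_z f2 z <= wnorm F.
  rewrite (fubini_tonelli1 f2 mf2 f20).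
  apply: ge0_le_integral_nomeas => x _; first by apply: integral_ge0.
  rewrite (_ : fubini_F _ f2 x = \int[mu]_y ((gauss 1 x * `|F x|)%:E * (K h y)%:E)); last first.
    by apply: eq_integral => y _; rewrite /f2 /= -EFinM mulrAC.
  rewrite ge0_integralZl//.
  - rewrite Kint mule1 lee_fin ler_wpM2r// ler_expR lerN2 ler_wpM2r ?sqnorm_ge0//.
    by rewrite invf_le1// ler1n.
  - by apply/measurable_EFinP; exact: measurable_heat_kernel.
  - by move=> y _; rewrite lee_fin.
  - by rewrite lee_fin mulr_ge0// gauss_ge0.
rewrite EFinD ge0_muleDl ?lee_fin ?powR_ge0// mul1e.
apply: le_trans (leeD I1 I2); rewrite -ge0_integralD//.
apply: ge0_le_integral_nomeas => z _; first exact: osc_integrand_ge0.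
rewrite -EFinD lee_fin -mulrDr ler_wpM2l ?weight_ge0//.
exact: ler_normB.
Qed.

(** By [oscillation_le_wnorm], the oscillations of a function and of an
    approximation differ by an amount that is small uniformly in the
    height. *)
Lemma recoverable_closed (F : T -> R) : measurable_fun setT F ->
  (forall e : R, (0 < e)%R -> exists G : T -> R, [/\ measurable_fun setT G,
    recoverable G & wnorm (F \- G)%R <= e%:E]) -> recoverable F.
Proof.
move=> mF H e e0; pose c := (2 `^ (n%:R / 2) + 1 : R)%R.
have c0 : (0 < c)%R by rewrite ltr_wpDl// powR_ge0.
have [G [mG rG FG]] := H (e / 2 / c)%R (divr_gt0 (divr_gt0 e0 (ltr0Sn _ 1)) c0).
have [d d0 dG] := rG _ (divr_gt0 e0 (ltr0Sn _ 1)).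
exists (Num.min d 8^-1)%R; first by rewrite lt_min d0 invr_gt0/=.
move=> h h0; rewrite lt_min => /andP[hd h8].
have mFG : measurable_fun setT (F \- G)%R by apply: measurable_funB.
apply: le_trans (oscillation_triangle h0 mG mFG _) _.
  move=> x y /=; have -> : (F x - F y = (G x - G y) + (F x - G x - (F y - G y)))%R by ring.
  exact: ler_normD.
rewrite [e in leRHS](_ : _ = e / 2 + e / 2)%R; last by field.
rewrite EFinD; apply: leeD; first exact: dG.
apply: le_trans (oscillation_le_wnorm h0 (ltW h8) mFG) _.
apply: (@le_trans _ _ (c%:E * (e / 2 / c)%:E)).
  by rewrite lee_wpmul2l// lee_fin ltW.
by rewrite -EFinM lee_fin mulrC divfK ?gt_eqF.
Qed.

(** Stated for an arbitrary F whose differences are dominated, so as to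
    cover sums as well as indicators of unions. *)
Lemma recoverable_triangle (F G1 G2 : T -> R) :
  measurable_fun setT G1 -> measurable_fun setT G2 -> recoverable G1 -> recoverable G2 ->
  (forall x y, `|F x - F y| <= `|G1 x - G1 y| + `|G2 x - G2 y|)%R -> recoverable F.
Proof.
move=> m1 m2 r1 r2 FG e e0.
have [d1 d10 H1] := r1 _ (divr_gt0 e0 (ltr0Sn _ 1)).
have [d2 d20 H2] := r2 _ (divr_gt0 e0 (ltr0Sn _ 1)).
exists (Num.min d1 d2); first by rewrite lt_min d10.
move=> h h0; rewrite lt_min => /andP[hd1 hd2].
apply: le_trans (oscillation_triangle h0 m1 m2 FG) _.
rewrite [e in leRHS](_ : _ = e / 2 + e / 2)%R; last by field.
by rewrite EFinD; apply: leeD; [exact: H1|exact: H2].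
Qed.

End recovery.

Section recoverable_sets.
Context (R : realType) (n : nat).
Notation T := (n.-tuple (measurableTypeR R)).
Notation mu := (borel_lebesgue R n).
Notation K h y := (heat_kernel h (y : Rn R n)).
Local Open Scope ereal_scope.

Lemma wnorm_dominated (G : nat -> T -> R) (F H : T -> R) :
  (forall k, measurable_fun setT (G k)) -> measurable_fun setT F -> measurable_fun setT H ->
  (forall x, G k x @[k --> \oo] --> F x) -> (forall k x, (`|G k x| <= H x)%R) ->
  wnorm H < +oo -> forall e : R, (0 < e)%R -> exists k, wnorm (F \- G k)%R <= e%:E.
Proof.
move=> mG mF mH GF GH Hoo e e0.
have mw (f : T -> R) : measurable_fun setT f ->
    measurable_fun setT (fun x : T => (gauss 2^-1 x * f x)%:E).
  move=> mf; apply/measurable_EFinP.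
  by apply: measurable_funM => //; exact: measurable_gauss.
have H0 x : (0 <= H x)%R by apply: le_trans (GH 0%N x).
have iH : mu.-integrable setT (fun x : T => (gauss 2^-1 x * H x)%:E).
  apply/integrableP; split; first exact: mw.
  rewrite (_ : \int[mu]_x _ = wnorm H)//.
  by apply: eq_integral => x _; rewrite abse_EFin normrM (ger0_norm (gauss_ge0 _ _)).
have dom : {ae mu, forall x k, setT x -> `|(gauss 2^-1 x * G k x)%:E| <= (gauss 2^-1 x * H x)%:E}.
  apply: aeW => x k _; rewrite lee_fin normrM (ger0_norm (gauss_ge0 _ _)).
  by rewrite ler_wpM2l// gauss_ge0.
have cv : {ae mu, forall x, setT x -> (gauss 2^-1 x * G k x)%:E @[k --> \oo] --> (gauss 2^-1 x * F x)%:E}.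
  apply: aeW => x _; apply: cvg_EFin; first exact: nearW.
  by apply: cvgMr; exact: GF.
have [_ + _] := @dominated_convergence _ _ _ mu setT measurableT
  (fun k x => (gauss 2^-1 x * G k x)%:E) (fun x => (gauss 2^-1 x * F x)%:E)
  (fun x => (gauss 2^-1 x * H x)%:E) (fun k => mw _ (mG k)) (mw _ mF) cv iH dom.
move=> /fine_cvgP[finN /cvgrPdist_le /(_ e e0) leN].
have [N _ HN] := filterI finN leN.
have [/= fk lk] := HN N (leqnn N); exists N.
have -> : wnorm (F \- G N)%R =
    \int[mu]_x `|(gauss 2^-1 x * G N x)%:E - (gauss 2^-1 x * F x)%:E|.
  apply: eq_integral => x _; rewrite -EFinB abse_EFin -mulrBr normrM.
  by rewrite (ger0_norm (gauss_ge0 _ _)) distrC.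
rewrite -(fineK fk) lee_fin; apply: le_trans lk.
by rewrite sub0r normrN ler_norm.
Qed.

Lemma recoverable_scale (c : R) (F : T -> R) : measurable_fun setT F ->
  recoverable F -> recoverable (fun x => c * F x)%R.
Proof.
move=> mF rF e e0; pose a := (`|c| + 1)%R.
have a0 : (0 < a)%R by rewrite ltr_wpDl.
have [d d0 H] := rF _ (divr_gt0 e0 a0); exists d => // h h0 hd.
apply: (@le_trans _ _ (a%:E * oscillation h F)).
  rewrite /oscillation -ge0_integralZl//.
  - apply: ge0_le_integral_nomeas => z _; first exact: (osc_integrand_ge0 (fun x => c * F x)%R).
    rewrite -EFinM lee_fin -mulrBr normrM mulrCA ler_wpM2r//.
      by rewrite mulr_ge0// weight_ge0.
    by rewrite /a lerDl.
  - exact: measurable_osc_integrand.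
  - by move=> z _; exact: osc_integrand_ge0.
  - by rewrite lee_fin ltW.
apply: (@le_trans _ _ (a%:E * (e / a)%:E)).
  by rewrite lee_wpmul2l ?H// lee_fin ltW.
by rewrite -EFinM lee_fin mulrC divfK// gt_eqF.
Qed.

Definition recoverable_set (A : set T) := measurable A /\ recoverable (\1_A : T -> R).

Lemma wnorm_cst1 : wnorm (cst 1%R : T -> R) < +oo.
Proof.
have := @integral_gauss_lty R n 2^-1 (ltac:(by rewrite invr_gt0)).
by under eq_integral do rewrite -[expR _]mulr1 -[X in (_ * X)%R]normr1.
Qed.

Lemma recoverable_setC (A : set T) : recoverable_set A -> recoverable_set (~` A).
Proof.
move=> [mA rA]; split; first exact: measurableC.
have mA' : measurable_fun setT (\1_A : T -> R) by exact: measurable_indic.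
have mc : measurable_fun setT (cst 0%R : T -> R) by exact: measurable_cst.
apply: (recoverable_triangle mA' mc rA).
  move=> e e0; exists 1%R => // h h0 _; rewrite /oscillation integral0_eq ?lee_fin ?ltW//.
  by move=> z _; rewrite subrr normr0 mulr0.
move=> x y; rewrite subrr normr0 addr0 !indicE !in_setC.
by case: (x \in A); case: (y \in A); rewrite /= ?subrr ?subr0 ?sub0r ?normrN.
Qed.

Lemma recoverable_setU (A B : set T) : recoverable_set A -> recoverable_set B ->
  recoverable_set (A `|` B).
Proof.
move=> [mA rA] [mB rB]; split; first exact: measurableU.
have mA' : measurable_fun setT (\1_A : T -> R) by exact: measurable_indic.
have mB' : measurable_fun setT (\1_B : T -> R) by exact: measurable_indic.
apply: (recoverable_triangle mA' mB' rA rB).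
move=> x y; rewrite !indicE !in_setU.
case: (x \in A); case: (y \in A); case: (x \in B); case: (y \in B) => /=;
  rewrite ?subrr ?subr0 ?sub0r ?normrN ?normr1 ?normr0 ?addr0 ?add0r//; lra.
Qed.

Lemma recoverable_set0 : recoverable_set set0.
Proof.
split => // e e0; exists 1%R => // h h0 _; rewrite /oscillation integral0_eq ?lee_fin ?ltW//.
by move=> z _; rewrite !indicE !in_set0 subrr normr0 mulr0.
Qed.

(** The indicators of the finite unions converge in weighted mean, by
    dominated convergence. *)
Lemma recoverable_bigcup (A : (set T)^nat) : (forall k, recoverable_set (A k)) ->
  recoverable_set (\bigcup_k A k).
Proof.
move=> HA; have mU : measurable (\bigcup_k A k).
  by apply: bigcupT_measurable => k; have [] := HA k.
split => //; pose B k := \big[setU/set0]_(i < k) A i.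
have HB k : recoverable_set (B k).
  rewrite /B; elim: k => [|k IH]; first by rewrite big_ord0; exact: recoverable_set0.
  by rewrite big_ord_recr; apply: recoverable_setU.
apply: recoverable_closed; first exact: measurable_indic.
move=> e e0.
have mB k : measurable_fun setT (\1_(B k) : T -> R).
  by apply: measurable_indic; have [] := HB k.
have mI : measurable_fun setT (\1_(\bigcup_k A k) : T -> R) by exact: measurable_indic.
have mc : measurable_fun setT (cst 1%R : T -> R) by exact: measurable_cst.
have cv x : (\1_(B k) x : R) @[k --> \oo] --> (\1_(\bigcup_k A k) x : R).
  have [[i _ Aix]|nx] := pselect ((\bigcup_k A k) x).
    apply: cvg_near_cst; exists i.+1 => // k /= ik; rewrite !indicE !mem_set//.
      by exists i.
    by rewrite /B -bigcup_mkord; exists i.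
  apply: cvg_near_cst; apply: nearW => k; rewrite !indicE !memNset//.
  by rewrite /B -bigcup_mkord => -[i _ Aix]; apply: nx; exists i.
have bd k x : (`|\1_(B k) x : R| <= cst 1 x)%R.
  by rewrite indicE /=; case: (x \in B k); rewrite ?normr1 ?normr0.
have [k Hk] := wnorm_dominated mB mI mc cv bd wnorm_cst1 e0.
exists (\1_(B k)); split => //; last by have [] := HB k.
Qed.

Lemma recoverable_sigma_algebra : sigma_algebra setT recoverable_set.
Proof.
split; first exact: recoverable_set0.
- by move=> A; rewrite setTD; exact: recoverable_setC.
- exact: recoverable_bigcup.
Qed.

(** Only the first absolute moment of the heat kernel matters, and it is of
    the order of the square root of the height. *)
Lemma recoverable_lipschitz (phi : R -> R) (L : R) (i : 'I_n) : (0 <= L)%R ->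
  (forall a b, `|phi a - phi b| <= L * `|a - b|)%R -> measurable_fun setT phi ->
  recoverable (fun x : T => phi (tnth x i)).
Proof.
move=> L0 philip mphi e e0.
have mW : measurable_fun setT (fun x : T => (gauss 1 x)%:E).
  by apply/measurable_EFinP; exact: measurable_gauss.
have W0 (x : T) : 0 <= (gauss 1 x)%:E by rewrite lee_fin gauss_ge0.
pose W := fine (\int[mu]_x (gauss 1 x)%:E).
have WE : \int[mu]_x (gauss 1 x)%:E = W%:E.
  rewrite fineK// ge0_fin_numE; first exact: integral_gauss_lty.
  by apply: integral_ge0.
have WW0 : (0 <= W)%R by rewrite fine_ge0// integral_ge0.
pose M := (L * 16 * 2 `^ (n%:R / 2) * W + 1)%R.
have M0 : (0 < M)%R by rewrite ltr_wpDl// !mulr_ge0// powR_ge0.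
exists (Num.min 1 ((e / M) ^+ 2))%R.
  by rewrite lt_min ltr01 exprn_gt0// divr_gt0.
move=> h h0; rewrite lt_min => /andP[h1 hM].
have sM : (Num.sqrt h <= e / M)%R.
  have eM0 : (0 <= e / M)%R by rewrite divr_ge0// ltW.
  by rewrite -[leRHS](ger0_norm eM0) -sqrtr_sqr; apply: ler_wsqrtr; exact: ltW.
have h20 : (0 < 2 * h)%R by rewrite mulr_gt0.
pose c := (L * (16 * Num.sqrt h * 2 `^ (n%:R / 2)))%R.
have c0 : (0 <= c)%R by rewrite !mulr_ge0 ?powR_ge0 ?sqrtr_ge0.
pose f (z : T * T) := (c * (gauss 1 z.1 * K (2 * h) z.2))%:E.
have mf : measurable_fun setT f.
  by apply/measurable_EFinP; apply: measurable_funM => //; exact: measurable_weight.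
have f0 z : 0 <= f z by rewrite lee_fin mulr_ge0// weight_ge0.
apply: (@le_trans _ _ (\int[(mu \x mu)%E]_z f z)).
  apply: ge0_le_integral_nomeas => z _; first exact: (osc_integrand_ge0 (fun x : T => phi (tnth x i))).
  rewrite /f lee_fin tnth_mktuple.
  apply: (@le_trans _ _ (gauss 1 z.1 * K h z.2 * (L * `|tnth z.2 i|))%R).
    rewrite ler_wpM2l ?weight_ge0//; apply: le_trans (philip _ _) _.
    by rewrite (_ : tnth z.1 i - tnth z.2 i - tnth z.1 i = - tnth z.2 i)%R ?normrN//; ring.
  have := heat_kernel_first_moment z.2 i h0 (ltW h1).
  have := mulr_ge0 L0 (gauss_ge0 1 z.1).
  move=> LG /(ler_wpM2l LG); rewrite /c.
  set k1 := heat_kernel h _; set k2 := heat_kernel _ _; set g := gauss _ _; set a := `|_|%R.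
  set p := (2 `^ _)%R; set s := Num.sqrt h.
  lra.
rewrite (fubini_tonelli1 f mf f0).
rewrite (_ : \int[mu]_x _ = \int[mu]_x (c%:E * (gauss 1 x)%:E)); last first.
  apply: eq_integral => x _; rewrite /fubini_F /f.
  rewrite (_ : \int[mu]_y _ = \int[mu]_y ((c * gauss 1 x)%:E * (K (2 * h) y)%:E)); last first.
    by apply: eq_integral => y _; rewrite -EFinM mulrA.
  rewrite ge0_integralZl//.
  - by rewrite integral_heat_kernel// mule1 EFinM.
  - by apply/measurable_EFinP; exact: measurable_heat_kernel.
  - by move=> y _; rewrite lee_fin ltW// heat_kernel_gt0.
  - by rewrite lee_fin mulr_ge0// gauss_ge0.
rewrite ge0_integralZl//.
rewrite WE -EFinM lee_fin.
have : (Num.sqrt h * M <= e)%R by rewrite -ler_pdivlMr.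
rewrite /c /M; have := sqrtr_ge0 h; lra.
Qed.

(** The indicator is the pointwise limit of the ramps
    min(1, max(0, k (a - b))), which are Lipschitz. *)
Lemma recoverable_halfspace (i : 'I_n) (b : R) :
  recoverable_set [set x : T | (b < tnth x i)%R].
Proof.
have mE : measurable [set x : T | (b < tnth x i)%R].
  have -> : [set x : T | (b < tnth x i)%R] = setT `&` (@tnth n R)^~ i @^-1` `]b, +oo[%classic.
    by rewrite setTI; apply/seteqP; split => x /=; rewrite in_itv/= andbT.
  exact: measurable_tnth.
split => //.
pose phi (k : nat) (a : R) := (Num.min 1 (Num.max 0 (k%:R * (a - b))))%R.
have mphi k : measurable_fun setT (phi k).
  apply: measurable_minr => //; apply: measurable_maxr => //.
  by apply: measurable_funM => //; exact: measurable_funB.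
have mphit k : measurable_fun setT (fun x : T => phi k (tnth x i)).
  by apply: (measurableT_comp (mphi k)); exact: measurable_tnth.
apply: recoverable_closed; first exact: measurable_indic.
move=> e e0.
have mI : measurable_fun setT (\1_[set x : T | (b < tnth x i)%R] : T -> R).
  exact: measurable_indic.
have mc : measurable_fun setT (cst 1%R : T -> R) by exact: measurable_cst.
have cv (x : T) : phi k (tnth x i) @[k --> \oo] --> (\1_[set x : T | (b < tnth x i)%R] x : R).
  have [bx|xb] := ltP b (tnth x i).
    apply: cvg_near_cst.
    exists (Num.truncn (tnth x i - b)^-1).+1 => // k /= Nk.
    rewrite indicE mem_set//= /phi.
    have xb0 : (0 < tnth x i - b)%R by rewrite subr_gt0.
    have : (1 <= k%:R * (tnth x i - b))%R.
      rewrite -ler_pdivrMr// mul1r; apply: le_trans (ltW (truncnS_gt _)) _.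
      by rewrite ler_nat.
    move=> h1; rewrite min_l// le_max h1 orbT//.
  apply: cvg_near_cst; apply: nearW => k; rewrite indicE memNset//=; last first.
    by apply/negP; rewrite -leNgt.
  rewrite /phi max_l; first by rewrite min_r.
  by rewrite mulr_ge0_le0// subr_le0.
have bd k (x : T) : (`|phi k (tnth x i)| <= cst 1 x)%R.
  rewrite /phi /= ger0_norm ?ge_min ?lexx//.
  by rewrite le_min ler01 le_max lexx.
have [k Hk] := wnorm_dominated mphit mI mc cv bd wnorm_cst1 e0.
exists (fun x => phi k (tnth x i)); split => //.
apply: (@recoverable_lipschitz (phi k) k%:R i) => //.
move=> a a'; rewrite /phi.
have lipmax (u v : R) : (`|Num.max 0 u - Num.max 0 v| <= `|u - v|)%R.
  by case: (leP 0%R u) => ?; case: (leP 0%R v) => ?; rewrite ?subrr ?normr0//;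
    rewrite ?subr0 ?sub0r ?normrN;
    rewrite ler_norml; apply/andP; split; have := ler_norm (u - v)%R; have := ler_norm (v - u)%R;
    rewrite (distrC v u); have := normr_ge0 (u - v)%R; lra.
have lipmin (u v : R) : (`|Num.min 1 u - Num.min 1 v| <= `|u - v|)%R.
  by case: (leP 1%R u) => ?; case: (leP 1%R v) => ?; rewrite ?subrr ?normr0//;
    rewrite ler_norml; apply/andP; split; have := ler_norm (u - v)%R; have := ler_norm (v - u)%R;
    rewrite (distrC v u); have := normr_ge0 (u - v)%R; lra.
apply: le_trans (lipmin _ _) _; apply: le_trans (lipmax _ _) _.
by rewrite -mulrBr normrM (ger0_norm (ler0n _ _)) opprB addrA subrK.
Qed.

(** The Borel sets of R^n are generated by those of the coordinates, and
    these by open half-lines. *)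
Lemma measurable_recoverable (A : set T) : measurable A -> recoverable_set A.
Proof.
move=> mA.
have H i (B : set (measurableTypeR R)) : measurable B ->
    recoverable_set ((@tnth n R)^~ i @^-1` B).
  move=> mB; have {mB} : (@RGenOInfty.G R).-sigma.-measurable B by rewrite -RGenOInfty.measurableE.
  move: B; apply: smallest_sub.
    have [s0 sC sU] := recoverable_sigma_algebra.
    split.
    - by rewrite preimage_set0.
    - by move=> B HB; rewrite setTD preimage_setC; exact: recoverable_setC.
    - by move=> B HB; rewrite preimage_bigcup; exact: recoverable_bigcup.
  move=> _ [b ->] /=.
  rewrite (_ : _ @^-1` _ = [set x : T | (b < tnth x i)%R]); first exact: recoverable_halfspace.
  by apply/seteqP; split => x /=; rewrite in_itv/= andbT.
move: A mA; apply: smallest_sub; first exact: recoverable_sigma_algebra.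
rewrite -bigcup_seq => A [i _ [B mB <-]]; rewrite setTI; exact: H.
Qed.

End recoverable_sets.

Section recovery_ae.
Context (R : realType) (n : nat).
Notation T := (n.-tuple (measurableTypeR R)).
Notation mu := (borel_lebesgue R n).
Notation K h y := (heat_kernel h (y : Rn R n)).
Local Open Scope ereal_scope.

Import HBNNSimple.

Lemma recoverable_nnsfun (f : {nnsfun T >-> R}) : recoverable (f : T -> R).
Proof.
have [s fE] : exists s : seq R,
    (f : T -> R) = (fun x => \sum_(y <- s) y * \1_(f @^-1` [set y]) x)%R.
  exists (finmap.enum_fset (fset_set (range f))).
  by apply/funext => x; rewrite fimfunE fsbig_finite.
rewrite fE; elim: s {fE} => [|y s IH].
  under eq_fun do rewrite big_nil.
  move=> e e0; exists 1%R => // h h0 _; rewrite /oscillation integral0_eq ?lee_fin ?ltW//.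
  by move=> z _; rewrite subrr normr0 mulr0.
have mi z : measurable_fun setT (fun x : T => z * \1_(f @^-1` [set z]) x)%R.
  by apply: measurable_funM => //; apply: measurable_indic; exact: measurable_sfunP.
have ms : measurable_fun setT (fun x : T => \sum_(z <- s) z * \1_(f @^-1` [set z]) x)%R.
  by apply: measurable_sum.
apply: (recoverable_triangle (mi y) ms _ IH).
  apply: recoverable_scale; first by apply: measurable_indic; exact: measurable_sfunP.
  have mfy : measurable (f @^-1` [set y]) by exact: measurable_sfunP.
  by have [] := measurable_recoverable mfy.
move=> x x'; rewrite !big_cons.
set a := (y * _)%R; set b := (\sum_(j <- s) _)%R; set a' := (y * _)%R; set b' := (\sum_(j <- s) _)%R.
by rewrite (_ : a + b - (a' + b') = (a - a') + (b - b'))%R ?ler_normD//; ring.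
Qed.

Lemma recoverable_ge0 (F : T -> R) : measurable_fun setT F -> (forall x, 0 <= F x)%R ->
  wnorm F < +oo -> recoverable F.
Proof.
move=> mF F0 Foo; have mEF : measurable_fun setT (EFin \o F) by exact/measurable_EFinP.
pose g k := nnsfun_approx measurableT mEF k.
have EF0 x : setT x -> 0 <= (EFin \o F) x by rewrite /= lee_fin.
apply: recoverable_closed => // e e0.
have mg k : measurable_fun setT (g k : T -> R) by [].
have cv x : (g k x : R) @[k --> \oo] --> F x.
  by have /fine_cvgP[_] := cvg_nnsfun_approx measurableT mEF EF0 (I : setT x).
have bd k x : (`|(g k : T -> R) x| <= F x)%R.
  rewrite ger0_norm// -lee_fin /g nnsfun_approxE; exact: le_approx.
have [k Hk] := wnorm_dominated mg mF mF cv bd Foo e0.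
by exists (g k); split => //; exact: recoverable_nnsfun.
Qed.

Lemma le_wnorm (F G : T -> R) : (forall x, `|F x| <= `|G x|)%R -> wnorm F <= wnorm G.
Proof.
move=> FG; apply: ge0_le_integral_nomeas => x _; first by rewrite lee_fin mulr_ge0// gauss_ge0.
by rewrite lee_fin ler_wpM2l// gauss_ge0.
Qed.

Lemma recoverable_wnorm (F : T -> R) : measurable_fun setT F -> wnorm F < +oo -> recoverable F.
Proof.
move=> mF Foo.
pose G1 x := Num.max (F x) 0%R; pose G2 x := Num.max (- F x)%R 0%R.
have m1 : measurable_fun setT G1 by apply: measurable_maxr.
have m2 : measurable_fun setT G2.
  by apply: measurable_maxr => //; exact: measurableT_comp.
have FE x : F x = (G1 x - G2 x)%R.
  by rewrite /G1 /G2; case: (leP (F x) 0%R) => ?; case: (leP (- F x)%R 0%R) => ?; lra.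
have g10 x : (0 <= G1 x)%R by rewrite le_max lexx orbT.
have g20 x : (0 <= G2 x)%R by rewrite le_max lexx orbT.
have r1 : recoverable G1.
  apply: recoverable_ge0 => //; apply: le_lt_trans Foo; apply: le_wnorm => x.
  rewrite (ger0_norm (g10 x)) /G1; case: (leP (F x) 0%R) => // _; exact: ler_norm.
have r2 : recoverable G2.
  apply: recoverable_ge0 => //; apply: le_lt_trans Foo; apply: le_wnorm => x.
  rewrite (ger0_norm (g20 x)) /G2; case: (leP (- F x)%R 0%R) => // _.
  by rewrite -normrN; exact: ler_norm.
apply: (recoverable_triangle m1 m2 r1 r2) => x y; rewrite !FE.
rewrite (_ : G1 x - G2 x - (G1 y - G2 y) = (G1 x - G1 y) - (G2 x - G2 y))%R; last by ring.
exact: ler_normB.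
Qed.

(** The weighted norm is the Gaussian integral of F(0 - y), up to a
    reflection. *)
Lemma small_plus_integrable_wnorm (F : T -> R) : measurable_fun setT F ->
  small_plus_integrable F -> wnorm F < +oo.
Proof.
move=> mF FP; pose o : T := [tuple 0%R | i < n].
have := @integral_gauss_F_lty R n F FP o 2^-1 (ltac:(by rewrite invr_gt0)).
congr (_ < _); rewrite /wnorm.
rewrite -(@ge0_integral_reflect R n o (fun y => (gauss 2^-1 y * `|F y|)%:E)).
- apply: eq_integral => y _; congr (_ * _)%:E%R; rewrite /gauss; congr (expR (- (_ * _)))%R.
  by apply: eq_bigr => i _; rewrite !tnth_mktuple sub0r sqrrN.
- apply/measurable_EFinP; apply: measurable_funM; first exact: measurable_gauss.
  exact: measurableT_comp.
- by move=> y; rewrite lee_fin mulr_ge0// gauss_ge0.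
Qed.

(** Choose heights at which the oscillations tend to 0.  The infimum over
    these heights of the inner integrals has integral 0, so it vanishes almost
    everywhere; it dominates the infimum of |P_h F(x) - F(x)|. *)
Lemma heat_recovers (F : T -> R) : measurable_fun setT F -> small_plus_integrable F ->
  exists M : set T, [/\ measurable M, mu M = 0 & forall x, ~ M x ->
    forall e : R, (0 < e)%R -> exists2 h : R, (0 < h)%R &
    (`|\int[mu]_y (K h y * F (subT x y)) - F x| <= e)%R].
Proof.
move=> mF FP; have rF := recoverable_wnorm mF (small_plus_integrable_wnorm mF FP).
have H k : exists h : R, (0 < h)%R /\ oscillation h F <= (k.+1%:R^-1)%:E.
  have k0 : (0 < k.+1%:R^-1 :> R)%R by rewrite invr_gt0.
  have [d d0 Hd] := rF _ k0; exists (d / 2)%R; split; first by rewrite divr_gt0.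
  by apply: Hd; rewrite ?divr_gt0// ltr_pdivrMr// ltr_pMr// ltr1n.
have {H}[h Hh] := choice H.
have h0 k : (0 < h k)%R by have [] := Hh k.
pose j k (z : T * T) := (gauss 1 z.1 * K (h k) z.2 * `|F (subT z.1 z.2) - F z.1|)%:E.
have mj k : measurable_fun setT (j k) by exact: measurable_osc_integrand.
have j0 k z : 0 <= j k z by exact: osc_integrand_ge0.
pose W k x := \int[mu]_y j k (x, y).
have mW k : measurable_fun setT (W k).
  exact: (@measurable_fun_fubini_tonelli_F _ _ _ _ _ mu (j k) (mj k) (j0 k)).
have W0 k x : 0 <= W k x by apply: integral_ge0.
have IW k : \int[mu]_x W k x <= (k.+1%:R^-1)%:E.
  have [_] := Hh k; apply: le_trans; rewrite le_eqVlt; apply/orP; left; apply/eqP.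
  by rewrite /oscillation (fubini_tonelli1 (j k) (mj k) (j0 k)).
(* the infimum over all k *)
pose m x := einfs (W ^~ x) 0%N.
have mm : measurable_fun setT m by exact: measurable_fun_einfs.
have m0 x : 0 <= m x by apply: le_ereal_inf_tmp => _ [k _ <-].
have mWk k x : m x <= W k x by apply: ereal_inf_lbound; exists k.
have Im : \int[mu]_x `|m x| = 0.
  apply/eqP; rewrite eq_le integral_ge0// andbT.
  apply/lee_addgt0Pr => e e0; rewrite add0e.
  have [k ke] : exists k, (k.+1%:R^-1 <= e :> R)%R.
    exists (Num.truncn e^-1); apply/ltW; rewrite invf_plt ?posrE//; exact: truncnS_gt.
  apply: (@le_trans _ _ (\int[mu]_x W k x)).
    apply: ge0_le_integral_nomeas => x _; first exact: abse_ge0.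
    by rewrite gee0_abs.
  by apply: le_trans (IW k) _; rewrite lee_fin.
have [M [mM M0 Msub]] := (ae_eq_integral_abs mu measurableT mm).1 Im.
exists M; split => // x Mx e e0.
have mx : m x = 0 by apply: contrapT => h'; apply: Mx; apply: Msub => /= /(_ I).
have g0 := gauss_gt0 1 x.
have /ereal_inf_lt[_ [k _ <-] Wk] : m x < (e * gauss 1 x)%:E.
  by rewrite mx lte_fin mulr_gt0.
exists (h k) => //.
have mKF : measurable_fun setT (fun y : T => (K (h k) y * (F (subT x y) - F x))%R).
  apply: measurable_funM; first exact: measurable_heat_kernel.
  by apply: measurable_funB => //; apply: (measurableT_comp mF); exact: measurable_subTr.
have K0 y : (0 <= K (h k) y)%R by rewrite ltW// heat_kernel_gt0.
have WE : W k x = (gauss 1 x)%:E * \int[mu]_y `|(K (h k) y * (F (subT x y) - F x))%:E|.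
  rewrite -ge0_integralZl//.
  - apply: eq_integral => y _.
    by rewrite /j /= -EFinM normrM (ger0_norm (K0 y)) mulrA.
  - by apply: measurableT_comp => //; exact/measurable_EFinP.
  - by rewrite lee_fin ltW.
have le : \int[mu]_y `|(K (h k) y * (F (subT x y) - F x))%:E| <= e%:E.
  move: Wk; rewrite WE mulrC EFinM lte_pmul2l// => /ltW; exact.
have iKF : mu.-integrable setT (fun y : T => (K (h k) y * (F (subT x y) - F x))%:E).
  apply/integrableP; split; first exact/measurable_EFinP.
  by apply: le_lt_trans le _; exact: ltry.
have iK : mu.-integrable setT (fun y : T => (F x * K (h k) y)%:E).
  apply/integrableP; split.
    by apply/measurable_EFinP; apply: measurable_funM => //; exact: measurable_heat_kernel.
  under eq_integral => y _ do rewrite abse_EFin normrM (ger0_norm (K0 y)) EFinM.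
  rewrite ge0_integralZl//.
  - by rewrite integral_heat_kernel// mule1 ltry.
  - by apply/measurable_EFinP; exact: measurable_heat_kernel.
  - by move=> y _; rewrite lee_fin.
have IF : (\int[mu]_y (F x * K (h k) y))%R = F x.
  rewrite /Rintegral (_ : \int[mu]_y _ = \int[mu]_y ((F x)%:E * (K (h k) y)%:E)) //.
  rewrite integralZl//.
    by rewrite integral_heat_kernel// mule1.
  apply/integrableP; split; first by apply/measurable_EFinP; exact: measurable_heat_kernel.
  under eq_integral => y _ do rewrite abse_EFin (ger0_norm (K0 y)).
  by rewrite integral_heat_kernel// ltry.
have E : (\int[mu]_y (K (h k) y * F (subT x y)))%R =
    ((\int[mu]_y (K (h k) y * (F (subT x y) - F x)))%R + F x)%R.
  rewrite -[X in _ = (_ + X)%R]IF -RintegralD//.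
  by apply: eq_Rintegral => y _; ring.
rewrite E addrK -lee_fin EFin_normr_Rintegral//.
by apply: le_trans le; apply: le_abse_integral => //; exact/measurable_EFinP.
Qed.

End recovery_ae.

(** * The pointwise inequality and the theorem *)

Section pointwise.
Context (R : realType) (n m : nat) (r s C : R).
Hypotheses (n0 : (0 < n)%N).
Local Notation th := (r / (r - s)).
Hypotheses (r0 : 0 < r) (s0 : s < 0) (C0 : 0 < C).
Hypothesis interp : forall (v : nat -> R -> R) (A B : R), 0 < A -> 0 < B ->
  (forall j, (j < m)%N -> forall t : R, 0 < t -> is_derive t 1 (v j) (v j.+1 t)) ->
  (forall e : R, 0 < e -> exists X : R, forall t : R, X <= t -> `|v 0 t| < e) ->
  (forall t : R, 0 < t -> t `^ (m%:R - r / 2) * `|v m t| <= A) ->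
  (forall t : R, 0 < t -> t `^ (m%:R - s / 2) * `|v m t| <= B) ->
  forall t : R, 0 < t -> `|v 0 t| <= C * (A `^ (1 - th) * B `^ th).

Lemma tl_fun_ge0 (a : R) (f : Rn R n -> \bar R) x : (0 <= tl_fun m a +oo f x)%E.
Proof.
apply: (@le_trans _ _ (1 `^ (m%:R - a / 2) * `|heat_deriv m f 1 x|)%:E).
  by rewrite lee_fin mulr_ge0 ?powR_ge0.
by apply: ereal_sup_ubound; exists 1%R => //=.
Qed.

Lemma tl_fun_ub (a : R) (f : Rn R n -> \bar R) x (b : R) : (tl_fun m a +oo f x <= b%:E)%E ->
  forall t : R, 0 < t -> t `^ (m%:R - a / 2) * `|heat_deriv m f t x| <= b.
Proof.
move=> le t t0; rewrite -lee_fin; apply: le_trans le.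
by apply: ereal_sup_ubound; exists t.
Qed.

Lemma tl_fun_eq0 (a : R) (f : Rn R n -> \bar R) x : tl_fun m a +oo f x = 0%E ->
  forall t : R, 0 < t -> heat_deriv m f t x = 0.
Proof.
move=> f0 t t0; have := @tl_fun_ub a f x 0; rewrite f0 => /(_ (lexx _) t t0).
rewrite pmulr_rle0 ?powR_gt0// => h; apply/eqP.
by rewrite -normr_eq0 eq_le h normr_ge0.
Qed.

(** When one of the maximal functions vanishes at [x], so does the m-th
    derivative of the heat extension for all heights; the interpolation bound
    then holds with arbitrarily small constants, and F x = 0. *)
Lemma pointwise_interpolation (f : Rn R n -> \bar R) : S0 f -> L1_plus_Loo f ->
  exists2 N : set (Rn R n), leb R n N = 0%E & forall x, ~ N x ->
  (`|f x| <= C%:E * (tl_fun m r +oo f x `^ (1 - th) * tl_fun m s +oo f x `^ th))%E.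
Proof.
move=> f1 f2; have [F [M [mF mM M0 fF FP]]] := L1_plus_Loo_representative f1 f2.
have [M' [mM' M'0 rec]] := heat_recovers mF FP.
exists (M `|` M').
  apply/eqP; rewrite eq_le; apply/andP; split; last first.
    exact: (outer_measure_ge0 ((borel_lebesgue R n)^*)%mu).
  by apply: le_trans (leb_le_setU _ _) _; rewrite !leb_borel// M0 M'0 adde0.
move=> x /not_orP[Mx M'x].
have rs : 0 < r - s by rewrite subr_gt0; exact: lt_trans s0 r0.
have th0 : 0 < th by rewrite divr_gt0.
have th1 : 0 < 1 - th by rewrite subr_gt0 ltr_pdivrMr// mul1r ltrDl oppr_gt0.
pose s1 : seq (R * R * nat) := [:: ((4 * pi) `^ (- (n%:R / 2)), - (n%:R / 2), 0%N)].
pose v k := hcomb F x (iter k (@hcomb_derive R) s1).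
have dv k (h : R) : 0 < h -> is_derive h 1 (v k) (v k.+1 h).
  by move=> h0; exact: (is_derive_hcomb mF FP).
have hv h : 0 < h -> heat f h x = v 0 h.
  by move=> h0; rewrite (heat_representative _ _ mF mM M0 fF) (heat_integral_hcomb mF FP).
have heat_v h : 0 < h -> heat_deriv m f h x = v m h.
  by move=> h0; rewrite /heat_deriv; exact: (derive1n_chain hv dv).
have v_decay (e : R) : 0 < e -> exists X : R, forall t : R, X <= t -> `|v 0 t| < e.
  move=> e0; have [X HX] := heat_decay mF FP x n0 e0.
  exists (Num.max X 1) => t; rewrite ge_max => /andP[Xt t1].
  by rewrite /v /= -(heat_integral_hcomb mF FP) ?HX// (lt_le_trans ltr01).
have FxE : (`|f x| = `|F x|%:E)%E by rewrite fF.
have key (A B : R) : 0 < A -> 0 < B ->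
   (forall t : R, 0 < t -> t `^ (m%:R - r / 2) * `|heat_deriv m f t x| <= A) ->
   (forall t : R, 0 < t -> t `^ (m%:R - s / 2) * `|heat_deriv m f t x| <= B) ->
   `|F x| <= C * (A `^ (1 - th) * B `^ th).
  move=> A0 B0 HA HB; apply/ler_addgt0Pr => e e0.
  have [h h0 He] := rec x M'x e e0.
  have := interp A0 B0 (fun j _ => dv j) v_decay
    (fun t t0 => ltac:(rewrite -heat_v//; exact: HA))
    (fun t t0 => ltac:(rewrite -heat_v//; exact: HB)) h0.
  rewrite /v /= -(heat_integral_hcomb mF FP)//.
  set u := (\int[_]_y _)%R in He *.
  move=> le; have := ler_normB u (u - F x).
  rewrite opprB addrCA subrr addr0; lra.
have zero : (forall t : R, 0 < t -> heat_deriv m f t x = 0) -> F x = 0.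
  move=> d0; apply/eqP; rewrite -normr_eq0 eq_le normr_ge0 andbT.
  apply/ler_addgt0Pr => e e0; rewrite add0r.
  have eC : 0 < e / C by rewrite divr_gt0.
  apply: le_trans (key _ _ eC eC _ _) _.
  - by move=> t t0; rewrite d0// normr0 mulr0 ltW.
  - by move=> t t0; rewrite d0// normr0 mulr0 ltW.
  - rewrite -powRD; last by apply/implyP => _; rewrite gt_eqF.
    rewrite subrK powRr1; last exact: ltW.
    by rewrite mulrC divfK ?gt_eqF.
have RHS0 : (0 <= C%:E * (tl_fun m r +oo f x `^ (1 - th) * tl_fun m s +oo f x `^ th))%E.
  by rewrite mule_ge0 ?mule_ge0 ?poweR_ge0// lee_fin ltW.
have [A0|A0] := eqVneq (tl_fun m r +oo f x) 0%E.
  by rewrite FxE (zero (tl_fun_eq0 A0)) normr0.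
have [B0|B0] := eqVneq (tl_fun m s +oo f x) 0%E.
  by rewrite FxE (zero (tl_fun_eq0 B0)) normr0.
have A0' : (0 < tl_fun m r +oo f x)%E by rewrite lt_neqAle eq_sym A0 tl_fun_ge0.
have B0' : (0 < tl_fun m s +oo f x)%E by rewrite lt_neqAle eq_sym B0 tl_fun_ge0.
have [Ay|Ay] := eqVneq (tl_fun m r +oo f x) +oo%E.
  by rewrite Ay poweRyr ?gt_eqF// gt0_mulye ?poweR_gt0// gt0_muley ?leey// lte_fin.
have [By|By] := eqVneq (tl_fun m s +oo f x) +oo%E.
  by rewrite By poweRyr ?gt_eqF// gt0_muley ?poweR_gt0// gt0_muley ?leey// lte_fin.
have [a aE] : exists a : R, tl_fun m r +oo f x = a%:E.
  by case: (tl_fun m r +oo f x) A0' Ay => [a||]//; exists a.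
have [b bE] : exists b : R, tl_fun m s +oo f x = b%:E.
  by case: (tl_fun m s +oo f x) B0' By => [b||]//; exists b.
rewrite aE bE !poweR_EFin -!EFinM FxE lee_fin; apply: key.
- by rewrite -lte_fin -aE.
- by rewrite -lte_fin -bE.
- by apply: tl_fun_ub; rewrite aE.
- by apply: tl_fun_ub; rewrite bE.
Qed.

End pointwise.

Unset Implicit Arguments.
Set Strict Implicit.
Set Printing Implicit Defensive.

Theorem theorem6p1 (R : realType) (n m : nat) (p1 p2 r s theta p : R)
    (q1 q2 q : \bar R)
    (n_gt0 : (0 < n)%N)
    (p1_gt0 : 0 < p1) (p2_gt0 : 0 < p2)
    (q1_gt0 : (0 < q1)%E) (q2_gt0 : (0 < q2)%E)
    (r_gt0 : 0 < r) (s_lt0 : s < 0)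
    (m_gt : r < (2 * m)%:R)
    (thetaE : theta = r / (r - s))
    (pE : p^-1 = (1 - theta) / p1 + theta / p2)
    (qE : (q^-1 = (1 - theta)%:E / q1 + theta%:E / q2)%E) :
  exists c : R, forall f : Rn R n -> \bar R,
    S0 f -> L1_plus_Loo f ->
    (lorentz p q f <=
       c%:E * (tll_norm m r p1 q1 +oo f `^ (1 - theta)
               * tll_norm m s p2 q2 +oo f `^ theta))%E.
Proof.
have m0 : (0 < m)%N.
  by case: m m_gt => //; rewrite muln0 => /(lt_trans r_gt0); rewrite ltxx.
have rs : 0 < r - s by rewrite subr_gt0; exact: lt_trans s_lt0 r_gt0.
have th0 : 0 < theta by rewrite thetaE divr_gt0.
have th1 : theta < 1 by rewrite thetaE ltr_pdivrMr// mul1r ltrDl oppr_gt0.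
have [C C0 interp] := interpolate_derivative_bounds r_gt0 s_lt0 m0.
have [c Hc] := @lorentz_hoelder R n theta C p1 p2 p q1 q2 q
  th0 th1 C0 p1_gt0 p2_gt0 pE q1_gt0 q2_gt0 qE.
exists c => f f1 f2.
have [N N0 fN] := pointwise_interpolation n_gt0 r_gt0 s_lt0 C0 interp f1 f2.
apply: Hc N0 _ => [x|x|]; [exact: tl_fun_ge0|exact: tl_fun_ge0|].
by rewrite thetaE.
Qed.
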